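(* For every $k\geq 1$ and every $b\geq 1$, Max Weighted $b$-Save is polynomial-time solvable on $k$-stars.
   Context: A star is a tree consisting of one vertex (its center) adjacent to all other vertices. A $k$-star ($k\ge1$) is a tree obtained from a star by replacing any of its edges by a path of length at most $k$. Firefighter process with budget $b$: given a graph $G=(V,E)$ and a vertex $s\in V$, at time $0$ the vertex $s$ is burned and every other vertex is vulnerable. A protection strategy is a set $\Phi \subseteq V \times \{1,\dots,|V|\}$; vertex $v$ is protected at time $t$ if $(v,t)\in\Phi$. At each time step $t \ge 1$, the vertices $v$ with $(v,t)\in \Phi$ become protected (and stay protected forever), and then every vulnerable vertex (neither burned nor protected) adjacent to a burned vertex becomes burned at time $t+1$. $\Phi$ is valid with respect to budget $b$ if (1) whenever $(v,t)\in\Phi$, $v$ is not burned at time $t$, and (2) for each $t$, at most $b$ pairs $(v,t)$ lie in $\Phi$. A vertex is saved if it is protected or every path from a burned vertex to it contains a protected vertex. Max Weighted $b$-Save: given a graph $G=(V,E)$, a burned vertex $s\in V$, a subset $S\subseteq V$ and a weight function $w:S\to\mathbb{N}$, find a valid strategy with respect to budget $b$ maximizing the total weight of the saved vertices belonging to $S$. *)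

(* Defs.v *)
From mathcomp Require Import all_boot boolp.
Set Implicit Arguments.
Unset Strict Implicit.
Unset Printing Implicit Defensive.

(** * Polynomial time

    The machine model is the WHILE language over binary trees of N. D. Jones
    (Computability and Complexity from a Programming Perspective, 1997).
    The cost measure is a logarithmic (size-charging) one: evaluating an
    expression costs the total size of the values of all its subexpressions,
    without any credit for sharing.  With this measure the model and Turing
    machines simulate each other with polynomial overhead. *)

Inductive tree : Type := Leaf | Node of tree & tree.

Fixpoint tsize (x : tree) : nat :=
  if x is Node l r then (tsize l + tsize r).+1 else 1.

Fixpoint teq (x y : tree) : bool :=
  match x, y with
  | Leaf, Leaf => true
  | Node l r, Node l' r' => teq l l' && teq r r'
  | _, _ => false
  end.

Definition is_node (x : tree) : bool := if x is Node _ _ then true else false.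
Definition left_tree (x : tree) : tree := if x is Node l _ then l else Leaf.
Definition right_tree (x : tree) : tree := if x is Node _ r then r else Leaf.

Definition tbool (c : bool) : tree := if c then Node Leaf Leaf else Leaf.

Inductive expr : Type :=
  | EVar of nat
  | EConst of tree
  | ECons of expr & expr
  | EHd of expr
  | ETl of expr
  | EEq of expr & expr.

Definition store := nat -> tree.

Fixpoint eval (st : store) (E : expr) : tree :=
  match E with
  | EVar x => st x
  | EConst d => d
  | ECons E1 E2 => Node (eval st E1) (eval st E2)
  | EHd E1 => left_tree (eval st E1)
  | ETl E1 => right_tree (eval st E1)
  | EEq E1 E2 => tbool (teq (eval st E1) (eval st E2))
  end.

Fixpoint ecost (st : store) (E : expr) : nat :=
  tsize (eval st E) +
  match E with
  | EVar _ | EConst _ => 0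
  | ECons E1 E2 | EEq E1 E2 => ecost st E1 + ecost st E2
  | EHd E1 | ETl E1 => ecost st E1
  end.

Inductive cmd : Type :=
  | Skip
  | Assign of nat & expr
  | Seq of cmd & cmd
  | If of expr & cmd & cmd
  | While of expr & cmd.

Definition update (st : store) (x : nat) (d : tree) : store :=
  fun y => if y == x then d else st y.

(** [exec C st st' t]: started in [st], [C] halts in [st'] at total cost [t]. *)
Inductive exec : cmd -> store -> store -> nat -> Prop :=
  | exec_skip st : exec Skip st st 1
  | exec_assign st x E :
      exec (Assign x E) st (update st x (eval st E)) (ecost st E)
  | exec_seq C1 C2 st st1 st2 t1 t2 :
      exec C1 st st1 t1 -> exec C2 st1 st2 t2 ->
      exec (Seq C1 C2) st st2 (t1 + t2)
  | exec_if_true E C1 C2 st st1 t :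
      is_node (eval st E) -> exec C1 st st1 t ->
      exec (If E C1 C2) st st1 (ecost st E + t)
  | exec_if_false E C1 C2 st st1 t :
      ~~ is_node (eval st E) -> exec C2 st st1 t ->
      exec (If E C1 C2) st st1 (ecost st E + t)
  | exec_while_false E C st :
      ~~ is_node (eval st E) -> exec (While E C) st st (ecost st E)
  | exec_while_true E C st st1 st2 t1 t2 :
      is_node (eval st E) -> exec C st st1 t1 -> exec (While E C) st1 st2 t2 ->
      exec (While E C) st st2 (ecost st E + t1 + t2).

(** Variable 0 holds the input at the start and the output at the end. *)
Definition init_store (d : tree) : store := fun x => if x == 0 then d else Leaf.

(** Some program, on the encoding of every instance [x] in the class [dom],
    halts within polynomial cost with an output that is a correct answer for
    [x].  Since [0 < tsize d], every polynomial in [tsize d] is bounded by some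
    [a * tsize d ^ r]. *)
Definition poly_time_solvable (I : Type) (enc : I -> tree) (dom : I -> Prop)
    (answer : I -> tree -> Prop) : Prop :=
  exists (C : cmd) (a r : nat), forall x : I, dom x ->
    exists (st : store) (t : nat),
      [/\ exec C (init_store (enc x)) st t,
          t <= a * tsize (enc x) ^ r
        & answer x (st 0)].

(** * k-stars *)

Definition isomorphic (T U : Type) (e : rel T) (f : rel U) : Prop :=
  exists2 h : T -> U, bijective h & forall x y, e x y = f (h x) (h y).

(** The star with center [None] and [m] edges, in which the [i]-th edge is
    replaced by a path of length [len i] (that is, with [len i] edges), whose
    successive vertices are the center, [(i, 0)], ..., [(i, len i - 1)]. *)
Definition leg_vertex (m : nat) (len : 'I_m -> nat) : Type :=
  option {i : 'I_m & 'I_(len i)}.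

Definition leg_step (m : nat) (len : 'I_m -> nat) (x y : leg_vertex len) : bool :=
  match x, y with
  | None, Some q => tagged q == 0 :> nat
  | Some p, Some q => (tag p == tag q) && ((tagged p).+1 == tagged q :> nat)
  | _, None => false
  end.

Definition leg_adj (m : nat) (len : 'I_m -> nat) : rel (leg_vertex len) :=
  fun x y => leg_step x y || leg_step y x.

Definition is_kstar (k : nat) (T : Type) (e : rel T) : Prop :=
  exists (m : nat) (len : 'I_m -> nat),
    (forall i, 1 <= len i <= k) /\ isomorphic e (@leg_adj m len).

(** * The firefighter process *)

(** Only the values of [weight] on [target] are meaningful. *)
Record instance : Type := Instance {
  nvertices : nat;
  edge : rel 'I_nvertices;
  edge_sym : symmetric edge;
  edge_irr : irreflexive edge;
  source : 'I_nvertices;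
  target : {set 'I_nvertices};
  weight : 'I_nvertices -> nat
}.

(** Time steps range over 1, ..., n: the pair [(v, i)] with [i : 'I_n] stands
    for protecting [v] at time [i.+1]. *)
Definition strategy (n : nat) : Type := {set 'I_n * 'I_n}.

Definition protected (n : nat) (Phi : strategy n) (t : nat) : {set 'I_n} :=
  [set v | [exists i : 'I_n, (i.+1 <= t) && ((v, i) \in Phi)]].

(** The fire does not spread between times 0 and 1: the first spreading takes
    place at time step 1, after the first protections, and yields the vertices
    burned at time 2. *)
Fixpoint burned (n : nat) (e : rel 'I_n) (s : 'I_n) (Phi : strategy n)
    (t : nat) : {set 'I_n} :=
  if t is t'.+1 then
    burned e s Phi t' :|:
    [set v | [&& 1 <= t', v \notin protected Phi t'
               & [exists u in burned e s Phi t', e u v]]]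
  else [set s].

Definition valid (b n : nat) (e : rel 'I_n) (s : 'I_n) (Phi : strategy n) : Prop :=
  (forall v i, (v, i) \in Phi -> v \notin burned e s Phi i.+1) /\
  (forall i, #|[set v | (v, i) \in Phi]| <= b).

Definition ever_protected (n : nat) (Phi : strategy n) (v : 'I_n) : bool :=
  [exists i : 'I_n, (v, i) \in Phi].

Definition saved (n : nat) (e : rel 'I_n) (s : 'I_n) (Phi : strategy n)
    (v : 'I_n) : Prop :=
  ever_protected Phi v \/
  forall (u : 'I_n) (p : seq 'I_n),
    (exists t, u \in burned e s Phi t) ->
    path e u p -> uniq (u :: p) -> last u p = v ->
    has (ever_protected Phi) (u :: p).

Definition saved_weight (x : instance) (Phi : strategy (nvertices x)) : nat :=
  \sum_(v in target x | `[< saved (@edge x) (source x) Phi v >]) weight v.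

Definition optimal (b : nat) (x : instance) (Phi : strategy (nvertices x)) : Prop :=
  valid b (@edge x) (source x) Phi /\
  forall Psi : strategy (nvertices x), valid b (@edge x) (source x) Psi ->
    saved_weight Psi <= saved_weight Phi.

(** * Encodings *)

Definition enc_seq (ds : seq tree) : tree := foldr Node Leaf ds.

Definition enc_fun (n : nat) (f : 'I_n -> tree) : tree :=
  enc_seq [seq f i | i <- enum 'I_n].

Definition enc_rel (n : nat) (e : rel 'I_n) : tree :=
  enc_fun (fun u => enc_fun (fun v => tbool (e u v))).

(** Binary, least significant bit first, without leading zeros:
    [up_log 2 m.+1] is the least [l] such that [m < 2 ^ l]. *)
Definition enc_nat (m : nat) : tree :=
  enc_seq [seq tbool (odd (m %/ 2 ^ i)) | i <- iota 0 (up_log 2 m.+1)].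

(** The adjacency matrix, the characteristic vector of the source, and the
    target set with its weights: [Leaf] for a vertex outside the target set. *)
Definition enc_instance (x : instance) : tree :=
  enc_seq [:: enc_rel (@edge x);
              enc_fun (fun v => tbool (v == source x));
              enc_fun (fun v => if v \in target x
                                then Node Leaf (enc_nat (weight v))
                                else Leaf)].

(** The matrix with one row per vertex and one column per time step. *)
Definition enc_strategy (n : nat) (Phi : strategy n) : tree :=
  enc_rel (fun v i => (v, i) \in Phi).

Definition max_weighted_save_answer (b : nat) (x : instance) (d : tree) : Prop :=
  exists2 Phi : strategy (nvertices x), optimal b Phi & d = enc_strategy Phi.

(* Main.v *)
Require Import Defs.
From mathcomp Require Import all_boot.
From mathcomp Require Import boolp zify.
Import Defs.

(** A vertex that catches fire at time t + 1 is the end of a simple path with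
    t + 1 vertices that starts at the source, and a simple path of a k-star has
    at most 2k + 1 vertices: at most k on the leg where it starts, the center,
    and at most k on the leg where it ends.  The fire is therefore over at time
    2k + 1, so that pairs with a later time can be dropped from a strategy
    without changing the burned vertices.  What is left has at most (2k + 1) b
    pairs.  As k and b are fixed, there are polynomially many sets of that many
    pairs, and an exhaustive search that simulates the fire for each of them
    takes polynomial time. *)

Set Implicit Arguments.
Unset Strict Implicit.
Unset Printing Implicit Defensive.

(** * Polynomial bounds *)

(** The search has to run in a concrete machine model that charges the size of every value it
    evaluates, so a large share of the work is a set of closure rules for polynomial-time functions.
    The delicate rule is iteration: a polynomial-time step may square the size of a state, and a
    loop of such steps leaves polynomial time. Every fold therefore needs its own reason why its
    intermediate states stay small. Vertices and times never exceed the number of vertices and can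
    be kept in unary; weights come in binary and are added and compared digit by digit. The bound on
    simple paths is all that is used of a k-star, so the program never has to locate the center or
    the legs. On any graph the fire is over by the time equal to the number of vertices, and for a
    valid strategy the saved vertices are exactly those not burned by then; this replaces the
    quantification over paths by a simulation. *)

Definition poly_bounded (g : nat -> nat) : Prop :=
  exists r, forall s, g s <= s.+2 ^ r.

Lemma poly_bounded_le g h :
  (forall s, g s <= h s) -> poly_bounded h -> poly_bounded g.
Proof. by move=> gh [r hr]; exists r => s; apply: leq_trans (gh s) (hr s). Qed.

Lemma leq_expn2 x y r : x <= y -> x ^ r <= y ^ r.
Proof. by case: r => // r xy; rewrite leq_exp2r. Qed.

(** The base [s.+2] is at least 2 even at [s = 0], so the exponent alone absorbs any constant. This
    is why [poly_bounded] carries no leading coefficient. *)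
Lemma poly_bounded_const c : poly_bounded (fun=> c).
Proof.
exists c => s; apply: leq_trans (ltnW (ltn_expl c (leqnn 2))) _.
exact: leq_expn2.
Qed.

Lemma poly_bounded_id : poly_bounded id.
Proof. by exists 1 => s; rewrite expn1; lia. Qed.

Lemma poly_bounded_add g h :
  poly_bounded g -> poly_bounded h -> poly_bounded (fun s => g s + h s).
Proof.
move=> [r gr] [q hq]; exists (r + q).+1 => s.
rewrite expnS (expnD _ r q).
have := gr s; have := hq s.
have := expn_gt0 s.+2 r; have := expn_gt0 s.+2 q.
by move: (s.+2 ^ r) (s.+2 ^ q) => x y /=; nia.
Qed.

Lemma poly_bounded_mul g h :
  poly_bounded g -> poly_bounded h -> poly_bounded (fun s => g s * h s).
Proof.
by move=> [r gr] [q hq]; exists (r + q) => s; rewrite expnD leq_mul.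
Qed.

Lemma poly_bounded_comp g h :
  poly_bounded g -> poly_bounded h -> poly_bounded (fun s => g (h s)).
Proof.
move=> [r gr] [q hq]; exists (q.+2 * r) => s.
apply: leq_trans (gr _) _; rewrite expnM.
apply: leq_expn2; rewrite !expnS.
have := hq s; have := expn_gt0 s.+2 q.
by move: (s.+2 ^ q) => x /=; nia.
Qed.

Lemma poly_bounded_exp h r :
  poly_bounded h -> poly_bounded (fun s => (h s).+2 ^ r).
Proof.
by move=> hb; apply: (poly_bounded_comp (g := fun s => s.+2 ^ r)) hb; exists r.
Qed.

(** * Polynomial-time functions on encoded data *)

Lemma tsize_gt0 d : 0 < tsize d. Proof. by case: d. Qed.

Lemma tsize_left d : tsize (left_tree d) <= tsize d.
Proof. by case: d => //= l r; rewrite -addnS leq_addr. Qed.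

Lemma tsize_right d : tsize (right_tree d) <= tsize d.
Proof. by case: d => //= l r; lia. Qed.

Lemma tsize_eval_le st E : tsize (eval st E) <= ecost st E.
Proof. by case: E => *; rewrite /= leq_addr. Qed.

(** Each assignment pays for the size of the value it stores. A bound on the cost is thus also a
    bound on the size of the output, which is what composition needs. *)
Lemma exec_tsize C st st' t y :
  exec C st st' t -> tsize (st' y) <= tsize (st y) + t.
Proof.
elim=> {C st st' t}.
- by move=> st; lia.
- move=> st x E; rewrite /update; case: eqP => _; last by lia.
  by apply: leq_trans (tsize_eval_le _ _) _; lia.
- by move=> C1 C2 st st1 st2 t1 t2 _ ? _ ?; lia.
- by move=> E C1 C2 st st1 t _ _ ?; lia.
- by move=> E C1 C2 st st1 t _ _ ?; lia.
- by move=> *; lia.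
- by move=> E C st st1 st2 t1 t2 _ _ ? _ ?; lia.
Qed.

(** * Execution within a cost bound *)

(** A total-correctness triple in continuation form: [Q] may itself be a [run], so that a sequence
    of commands is verified from left to right. *)
Definition run (C : cmd) (st : store) (c : nat) (Q : store -> Prop) : Prop :=
  exists st' t, [/\ exec C st st' t, t <= c & Q st'].

Lemma run_weaken C st c c' (Q Q' : store -> Prop) :
  c <= c' -> (forall st', Q st' -> Q' st') -> run C st c Q -> run C st c' Q'.
Proof.
by move=> cc' QQ' [st' [t [ex tc q]]]; exists st', t; split; [|lia|exact: QQ'].
Qed.

Lemma run_assign st x E c (Q : store -> Prop) :
  ecost st E <= c -> Q (update st x (eval st E)) -> run (Assign x E) st c Q.
Proof. by move=> cE q; do 2!eexists; split; [apply: exec_assign| |]. Qed.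

Lemma run_seq C1 C2 st c1 c2 (Q : store -> Prop) :
  run C1 st c1 (fun st1 => run C2 st1 c2 Q) -> run (Seq C1 C2) st (c1 + c2) Q.
Proof.
move=> [st1 [t1 [ex1 le1 [st2 [t2 [ex2 le2 q]]]]]].
by exists st2, (t1 + t2); split=> //; [apply: exec_seq ex1 ex2 | apply: leq_add].
Qed.

Lemma run_if st E C1 C2 c (Q : store -> Prop) :
  run (if is_node (eval st E) then C1 else C2) st c Q ->
  run (If E C1 C2) st (ecost st E + c) Q.
Proof.
case: ifPn => b [st1 [t1 [ex1 le1 q]]]; exists st1, (ecost st E + t1).
  by split; [apply: exec_if_true| lia |].
by split; [apply: exec_if_false| lia |].
Qed.

Lemma run_while_stop st E C (Q : store -> Prop) :
  ~~ is_node (eval st E) -> Q st -> run (While E C) st (ecost st E) Q.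
Proof.
by move=> b q; exists st, (ecost st E); split=> //; apply: exec_while_false.
Qed.

Lemma run_while_step st E C c1 c2 (Q : store -> Prop) :
  is_node (eval st E) ->
  run C st c1 (fun st1 => run (While E C) st1 c2 Q) ->
  run (While E C) st (ecost st E + c1 + c2) Q.
Proof.
move=> b [st1 [t1 [ex1 le1 [st2 [t2 [ex2 le2 q]]]]]].
by exists st2, (ecost st E + t1 + t2); split; [apply: exec_while_true ex1 ex2 | lia |].
Qed.

Lemma update_same st x d : update st x d x = d.
Proof. by rewrite /update eqxx. Qed.

Lemma update_other st x d y : y != x -> update st x d y = st y.
Proof. by rewrite /update => /negbTE->. Qed.

(** * Data encoded as trees *)

Class encoding (T : Type) := encode : T -> tree.

#[export] Instance encoding_bool : encoding bool := tbool.
#[export] Instance encoding_unit : encoding unit := fun=> Leaf.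
#[export] Instance encoding_nat : encoding nat := fun n => iter n (Node Leaf) Leaf.
#[export] Instance encoding_prod A B (eA : encoding A) (eB : encoding B) :
  encoding (A * B) := fun p => Node (encode p.1) (encode p.2).
#[export] Instance encoding_seq A (eA : encoding A) : encoding (seq A) :=
  fun s => enc_seq (map encode s).
#[export] Instance encoding_option A (eA : encoding A) : encoding (option A) :=
  fun o => if o is Some x then Node Leaf (encode x) else Leaf.

Definition esize A (eA : encoding A) (x : A) : nat := tsize (encode x).
Arguments esize {A eA} x.

Lemma esize_gt0 A {eA : encoding A} (x : A) : 0 < esize x.
Proof. exact: tsize_gt0. Qed.

Lemma esize_bool (c : bool) : esize c <= 3.
Proof. by case: c. Qed.

Lemma esize_prod A B {eA : encoding A} {eB : encoding B} (p : A * B) :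
  esize p = (esize p.1 + esize p.2).+1.
Proof. by []. Qed.

Lemma esize_cons A {eA : encoding A} (x : A) s :
  esize (x :: s) = (esize x + esize s).+1.
Proof. by []. Qed.

Lemma esize_nil A {eA : encoding A} : esize ([::] : seq A) = 1.
Proof. by []. Qed.

Lemma esize_cat A {eA : encoding A} (s1 s2 : seq A) :
  esize (s1 ++ s2) = (esize s1 + esize s2).-1.
Proof.
elim: s1 => [|x s1 IH]; first by rewrite esize_nil.
have s2_gt0 : 0 < esize s2 by apply: esize_gt0.
by rewrite cat_cons !esize_cons IH; lia.
Qed.

Lemma esize_rev A {eA : encoding A} (s : seq A) : esize (rev s) = esize s.
Proof.
elim: s => // x s IH.
by rewrite rev_cons -cats1 esize_cat !esize_cons IH esize_nil; lia.
Qed.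

Lemma size_le_esize A {eA : encoding A} (s : seq A) : size s <= esize s.
Proof. by elim: s => //= x s IH; rewrite esize_cons; lia. Qed.

Lemma esize_behead A {eA : encoding A} (s : seq A) : esize (behead s) <= esize s.
Proof. by case: s => //= x s; rewrite esize_cons; lia. Qed.

Lemma esize_filter A {eA : encoding A} (p : pred A) (s : seq A) :
  esize (filter p s) <= esize s.
Proof. by elim: s => //= x s IH; case: (p x); rewrite !esize_cons; lia. Qed.

(* The argument and the result are in variable 0.  Preserving the variables
   above [m] lets a larger program keep its own data there while it calls [C].
   This is an inductive wrapper and not a definition, so that unification does
   not look through it. *)
Variant ptime A B {eA : encoding A} {eB : encoding B} (f : A -> B) : Prop :=
  Ptime of exists (C : cmd) (m r : nat),
    forall (x : A) (st : store), st 0 = encode x ->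
    run C st ((esize x).+2 ^ r)
      (fun st' => st' 0 = encode (f x) /\ forall j, m < j -> st' j = st j).

Lemma ptime_ext A B {eA : encoding A} {eB : encoding B} (f g : A -> B) :
  f =1 g -> ptime f -> ptime g.
Proof.
move=> fg [[C [m [r H]]]]; apply: Ptime; exists C, m, r => x st h.
by rewrite -fg; apply: H.
Qed.

Lemma ptime_recode A B B' {eA : encoding A} {eB : encoding B}
    {eB' : encoding B'} (f : A -> B) (g : A -> B') :
  (forall x, encode (f x) = encode (g x)) -> ptime f -> ptime g.
Proof.
move=> fg [[C [m [r H]]]]; apply: Ptime; exists C, m, r => x st h.
by rewrite -fg; apply: H.
Qed.

(** A cost bound that depends on the argument only through an upper bound [K] of its size. A loop
    can then charge the same amount to every call. *)
Lemma ptime_run A B {eA : encoding A} {eB : encoding B} (f : A -> B) :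
  ptime f ->
  exists (C : cmd) (m r : nat), forall K (x : A) (st : store),
    st 0 = encode x -> esize x <= K ->
    run C st (K.+2 ^ r)
      (fun st' => st' 0 = encode (f x) /\ forall j, m < j -> st' j = st j).
Proof.
move=> [[C [m [r H]]]]; exists C, m, r => K x st h xK.
by apply: run_weaken (H x st h) => //; apply: leq_expn2.
Qed.

Lemma ptime_esize A B {eA : encoding A} {eB : encoding B} (f : A -> B) :
  ptime f -> exists r, forall x, esize (f x) <= (esize x).+2 ^ r.
Proof.
move=> [[C [m [r H]]]].
have [q hq] : poly_bounded (fun s => s + s.+2 ^ r).
  by apply: poly_bounded_add poly_bounded_id _; exists r.
exists q => x; apply: leq_trans (hq _).
have [st' [t [ex tc [h _]]]] := H x (init_store (encode x)) (erefl _).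
have := exec_tsize 0 ex; rewrite h /esize => le; apply: leq_trans le _.
by rewrite leq_add2l.
Qed.

Lemma ptime_expr A B {eA : encoding A} {eB : encoding B} (E : expr) c
    (f : A -> B) :
  (forall st x, st 0 = encode x -> eval st E = encode (f x)) ->
  (forall st, ecost st E <= c * tsize (st 0) + c) -> ptime f.
Proof.
move=> evE costE.
have [r hr] : poly_bounded (fun s => c * s + c).
  apply: poly_bounded_add (poly_bounded_const _).
  exact: poly_bounded_mul (poly_bounded_const _) poly_bounded_id.
apply: Ptime; exists (Assign 0 E), 0, r => x st h; apply: run_assign.
  by apply: leq_trans (costE st) _; rewrite h; apply: hr.
split; first by rewrite update_same; apply: evE.
by move=> j j0; rewrite update_other // -lt0n.
Qed.

Lemma ptime_const A B {eA : encoding A} {eB : encoding B} (y : B) :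
  ptime (fun _ : A => y).
Proof.
apply: (@ptime_expr _ _ _ _ (EConst (encode y)) (esize y)) => //= st.
by rewrite addn0 leq_addl.
Qed.

Lemma ptime_id A {eA : encoding A} : ptime (fun x : A => x).
Proof.
by apply: (@ptime_expr _ _ _ _ (EVar 0) 1) => //= st; rewrite addn0 mul1n leq_addr.
Qed.

(** The cost of the second program is polynomial in the size of the intermediate value, which is
    itself polynomial by [ptime_esize]. *)
Lemma ptime_comp A B D {eA : encoding A} {eB : encoding B} {eD : encoding D}
    (g : B -> D) (f : A -> B) :
  ptime g -> ptime f -> ptime (fun x => g (f x)).
Proof.
move=> /ptime_run [C2 [m2 [r2 H2]]] pf; have [q hq] := ptime_esize pf.
case: pf => [[C1 [m1 [r1 H1]]]].
have [r hr] : poly_bounded (fun s => s.+2 ^ r1 + (s.+2 ^ q).+2 ^ r2).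
  by apply: poly_bounded_add; [exists r1 | apply: poly_bounded_exp; exists q].
apply: Ptime; exists (Seq C1 C2), (maxn m1 m2), r => x st h.
apply: run_weaken (hr _) (fun st' H => H) (run_seq _).
apply: run_weaken (H1 x st h) => // st1 [h1 k1].
apply: run_weaken (H2 _ _ _ h1 (hq x)) => // st2 [h2 k2].
by split=> // j mj; rewrite k2 ?k1 //; lia.
Qed.

Lemma ptime_pair A B D {eA : encoding A} {eB : encoding B} {eD : encoding D}
    (f : A -> B) (g : A -> D) :
  ptime f -> ptime g -> ptime (fun x => (f x, g x)).
Proof.
move=> pf pg; have [qf hqf] := ptime_esize pf; have [qg hqg] := ptime_esize pg.
case: pf pg => [[C1 [m1 [r1 H1]]]] [[C2 [m2 [r2 H2]]]].
pose m := maxn m1 m2.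
have [r hr] : poly_bounded (fun s => s + (s.+2 ^ r1 + (s.+2 ^ qf + (s +
    (s.+2 ^ r2 + (1 + s.+2 ^ qf + s.+2 ^ qg + s.+2 ^ qf + s.+2 ^ qg)))))).
  by do ![apply: poly_bounded_add | apply: poly_bounded_id
         | apply: poly_bounded_const | by eexists; move=> s; apply: leqnn].
apply: Ptime; exists (Seq (Assign m.+1 (EVar 0)) (Seq C1 (Seq (Assign m.+2 (EVar 0))
  (Seq (Assign 0 (EVar m.+1)) (Seq C2
  (Assign 0 (ECons (EVar m.+2) (EVar 0)))))))), m.+2, r => x st h.
apply: run_weaken (hr _) (fun st' H => H) _.
apply: run_seq; apply: run_assign; rewrite /= ?h ?addn0 //.
apply: run_seq; apply: run_weaken (H1 x _ _) => // st1 [h1 k1].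
apply: run_seq; apply: run_assign; rewrite /= ?h1 ?addn0; first exact: hqf.
apply: run_seq; apply: run_assign;
  rewrite /= ?addn0 update_other ?k1 ?update_same; try lia.
  by [].
apply: run_seq.
apply: run_weaken (H2 x _ _) => // st2 [h2 k2].
have e2 : st2 m.+2 = encode (f x).
  by rewrite k2 1?update_other ?update_same //; lia.
apply: run_assign; rewrite /= h2 e2.
  by have := hqf x; have := hqg x; rewrite /esize; lia.
split=> [|j mj]; first by rewrite update_same /= ?e2 ?h2.
by do 4!rewrite ?k2 ?k1 ?update_other //; lia.
Qed.

Lemma ptime_if A B {eA : encoding A} {eB : encoding B}
    (c : A -> bool) (f g : A -> B) :
  ptime c -> ptime f -> ptime g -> ptime (fun x => if c x then f x else g x).
Proof.
move=> [[C0 [m0 [r0 H0]]]] [[C1 [m1 [r1 H1]]]] [[C2 [m2 [r2 H2]]]].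
pose m := maxn m0 (maxn m1 m2).
have [r hr] : poly_bounded (fun s => s + (s.+2 ^ r0 + (3 +
    (s + (s.+2 ^ r1 + s.+2 ^ r2))))).
  by do ![apply: poly_bounded_add | apply: poly_bounded_id
         | apply: poly_bounded_const | by eexists; move=> s; apply: leqnn].
apply: Ptime; exists (Seq (Assign m.+1 (EVar 0)) (Seq C0
  (If (EVar 0) (Seq (Assign 0 (EVar m.+1)) C1)
               (Seq (Assign 0 (EVar m.+1)) C2)))), m.+1, r.
move=> x st h; apply: run_weaken (hr _) (fun st' H => H) _.
apply: run_seq; apply: run_assign; rewrite /= ?h ?addn0 //.
apply: run_seq; apply: run_weaken (H0 x _ _) => // st1 [h1 k1].
have e1 : st1 m.+1 = encode x by rewrite k1 ?update_same //; lia.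
(* The budget adds the costs of both branches, so that one bound serves whichever is taken. *)
apply: (@run_weaken _ _ (ecost st1 (EVar 0) +
  (esize x + ((esize x).+2 ^ r1 + (esize x).+2 ^ r2))) _ _ _ _ (fun st' H => H)).
  by rewrite leq_add2r /= h1 addn0; apply: (esize_bool (c x)).
apply: run_if; rewrite /= h1.
have -> : is_node (encode (c x)) = c x by case: (c x).
case: (c x); apply: run_seq; apply: run_assign; rewrite /= ?e1 ?addn0 //.
- apply: run_weaken (H1 x _ _) => [|st2 [h2 k2]|]; last by rewrite update_same.
    exact: leq_addr.
  by split=> // j mj; do 3!rewrite ?k2 ?k1 ?update_other //; lia.
- apply: run_weaken (H2 x _ _) => [|st2 [h2 k2]|]; last by rewrite update_same.
    exact: leq_addl.
  by split=> // j mj; do 3!rewrite ?k2 ?k1 ?update_other //; lia.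
Qed.

(* Variable [m.+1] holds the parameter, [m.+2] the rest of the list and [m.+3]
   the state. *)
Definition fold_body (m : nat) (C : cmd) : cmd :=
  Seq (Assign 0 (ECons (ECons (EVar m.+1) (EVar m.+3)) (EHd (EVar m.+2))))
  (Seq C (Seq (Assign m.+3 (EVar 0)) (Assign m.+2 (ETl (EVar m.+2))))).

(** Since [K] bounds the parameter, the list and the state after every prefix, all rounds have the
    same cost bound. The argument of a call is a triple of three values and two pair nodes, hence
    [3 * K + 2]. A round pays for the test, for building that triple, for the call, for storing the
    state and for advancing the list; the last [K] is the final test. *)
Lemma run_fold A S X {eA : encoding A} {eS : encoding S} {eX : encoding X}
    (f : A -> S -> X -> S) (C : cmd) (m r K : nat) (a : A) :
  (forall (x : A * S * X) (st : store), st 0 = encode x ->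
     esize x <= 3 * K + 2 ->
     run C st ((3 * K + 2).+2 ^ r)
      (fun st' => st' 0 = encode (f x.1.1 x.1.2 x.2) /\
                  forall j, m < j -> st' j = st j)) ->
  esize a <= K ->
  forall (l : seq X) (s : S) (st : store),
  st m.+1 = encode a -> st m.+2 = encode l -> st m.+3 = encode s ->
  esize l <= K ->
  (forall l1 l2, l = l1 ++ l2 -> esize (foldl (f a) s l1) <= K) ->
  run (While (EVar m.+2) (fold_body m C)) st
    (size l * (K + (10 * K + 10 + ((3 * K + 2).+2 ^ r + (K + 2 * K)))) + K)
    (fun st' => st' m.+3 = encode (foldl (f a) s l) /\
                forall j, m.+3 < j -> st' j = st j).
Proof.
move=> HC aK; elim=> [|x l IH] s st ha hl hs lK sK.
  apply: (@run_weaken _ _ (ecost st (EVar m.+2)) _ _ _ _ (fun st' H => H)).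
    by rewrite /= hl /= addn0; move: lK; rewrite esize_nil.
  by apply: run_while_stop => //=; rewrite hl.
have s_le : esize s <= K by apply: (sK [::] (x :: l)).
have s'_le : esize (f a s x) <= K by apply: (sK [:: x] l).
have xl_le : (esize x + esize l).+1 <= K by rewrite -esize_cons.
have hl' : st m.+2 = Node (encode x) (encode l) by rewrite hl.
set c := K + _.
apply: (@run_weaken _ _ (ecost st (EVar m.+2) +
  (10 * K + 10 + ((3 * K + 2).+2 ^ r + (K + 2 * K))) + (size l * c + K))
  _ _ _ _ (fun st' H => H)).
  rewrite /= hl addn0 (mulSn (size l)) -/c; move: lK; rewrite /esize.
  by rewrite {2}/c; move: (_ ^ r) (size l * c) => p q; lia.
apply: run_while_step; rewrite /= ?hl' //.
apply: run_seq; apply: run_assign; rewrite /= ?ha ?hs ?hl' /=.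
  by move: aK s_le xl_le; rewrite /esize; lia.
apply: run_seq; apply: run_weaken (HC (a, s, x) _ _ _) => //; last first.
  by rewrite !esize_prod /=; lia.
move=> st1 [/= h1 k1].
have e1 : st1 m.+1 = encode a by rewrite k1 ?update_other //; lia.
have e2 : st1 m.+2 = Node (encode x) (encode l) by rewrite k1 ?update_other //; lia.
apply: run_seq; apply: run_assign; rewrite /= h1 ?addn0 //.
have e3 : update st1 m.+3 (encode (f a s x)) m.+2 = Node (encode x) (encode l).
  by rewrite update_other //; lia.
apply: run_assign; rewrite /= e3 /=.
  by move: xl_le; rewrite /esize; lia.
apply: run_weaken (IH (f a s x) _ _ _ _ _ _) => // [st2 [h2 k2]|||||].
- by split=> // j mj; rewrite k2 // !update_other ?k1 ?update_other //; lia.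
- by rewrite !update_other //; lia.
- by rewrite update_same.
- by rewrite update_other ?update_same //; lia.
- by lia.
- by move=> l1 l2 ll; apply: (sK (x :: l1) l2); rewrite ll.
Qed.

(** The bound [g] on the states after all prefixes is a separate hypothesis because it does not
    follow from [f] being polynomial-time. *)
Lemma ptime_foldl A S X {eA : encoding A} {eS : encoding S} {eX : encoding X}
    (f : A -> S -> X -> S) (s : A -> S) (l : A -> seq X) (g : nat -> nat) :
  poly_bounded g ->
  (forall a l1 l2, l a = l1 ++ l2 ->
     esize (foldl (f a) (s a) l1) <= g (esize a)) ->
  ptime (fun p : A * S * X => f p.1.1 p.1.2 p.2) ->
  ptime s -> ptime l -> ptime (fun a => foldl (f a) (s a) (l a)).
Proof.
move=> gb gP /ptime_run [Cf [mf [rf Hf]]] ps pl.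
have [ql hql] := ptime_esize pl.
case: ps pl => [[Cs [ms [rs Hs]]]] [[Cl [ml [rl Hl]]]].
pose m := maxn mf (maxn ms ml).
pose K n := n + n.+2 ^ ql + g n.
have Kb : poly_bounded K.
  by apply: poly_bounded_add gb; apply: poly_bounded_add poly_bounded_id _; exists ql.
pose c n := K n + (10 * K n + 10 + ((3 * K n + 2).+2 ^ rf + (K n + 2 * K n))).
have [r hr] : poly_bounded (fun n => n + (n.+2 ^ rl + (K n + (n + (n.+2 ^ rs + (K n +
    (K n * c n + K n + K n))))))).
  by do ![apply: poly_bounded_exp | apply: poly_bounded_add
         | apply: poly_bounded_mul | apply: poly_bounded_id
         | exact: Kb | apply: poly_bounded_const].
apply: Ptime; exists (Seq (Assign m.+1 (EVar 0)) (Seq Cl (Seq (Assign m.+2 (EVar 0))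
  (Seq (Assign 0 (EVar m.+1)) (Seq Cs (Seq (Assign m.+3 (EVar 0))
  (Seq (While (EVar m.+2) (fold_body m Cf)) (Assign 0 (EVar m.+3))))))))), m.+3, r.
move=> a st h; apply: run_weaken (hr _) (fun st' H => H) _.
set n := esize a.
have aK : esize a <= K n by rewrite /K -/n; lia.
have lK : esize (l a) <= K n by have := hql a; rewrite /K -/n; lia.
have sK l1 l2 : l a = l1 ++ l2 -> esize (foldl (f a) (s a) l1) <= K n.
  by move/gP=> H; apply: leq_trans H _; rewrite leq_addl.
apply: run_seq; apply: run_assign; rewrite /= ?h ?addn0 //.
apply: run_seq; apply: run_weaken (Hl a _ _) => // st1 [h1 k1].
apply: run_seq; apply: run_assign; rewrite /= ?h1 ?addn0 //.
have e1 : update st1 m.+2 (encode (l a)) m.+1 = encode a.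
  by rewrite update_other ?k1 ?update_same //; lia.
apply: run_seq; apply: run_assign; rewrite /= ?e1 ?addn0 //.
apply: run_seq; apply: run_weaken (Hs a _ _) => // st2 [h2 k2].
apply: run_seq; apply: run_assign; rewrite /= ?h2 ?addn0.
  exact: (sK [::] (l a)).
apply: run_seq.
apply: run_weaken (@run_fold _ _ _ _ _ _ f Cf m rf (K n) a _ aK (l a) (s a)
  _ _ _ _ lK sK) => // [|st3 [h3 k3]||||].
- by rewrite leq_add2r leq_mul2r (leq_trans (size_le_esize _) lK) orbT.
- apply: run_assign; rewrite /= h3 ?addn0; first by apply: (sK _ [::]); rewrite cats0.
  split=> [|j mj]; first by rewrite update_same.
  by do 5!rewrite ?k3 ?k2 ?k1 ?update_other //; lia.
- move=> x st3 h3 xK; apply: run_weaken (Hf _ x st3 h3 xK) => // st4 [h4 k4].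
  by split=> // j mj; rewrite k4 //; lia.
- by rewrite update_other ?k2 1?update_other ?e1 //; lia.
- by rewrite update_other ?k2 1?update_other ?update_same //; lia.
- by rewrite update_same.
Qed.

(* A measure of the state that grows by a polynomial amount at each step,
    and not by a factor, keeps the state polynomial. *)
Lemma ptime_foldl_measure A S X {eA : encoding A} {eS : encoding S}
    {eX : encoding X} (mu : S -> nat) (d : nat) (h : nat -> nat)
    (f : A -> S -> X -> S) (s : A -> S) (l : A -> seq X) :
  (forall y, esize y <= d * mu y) ->
  (forall y, mu y <= esize y) ->
  (forall a y x, mu (f a y x) <= mu y + h (esize (a, x))) ->
  (forall n n', n <= n' -> h n <= h n') -> poly_bounded h ->
  ptime (fun p : A * S * X => f p.1.1 p.1.2 p.2) ->
  ptime s -> ptime l -> ptime (fun a => foldl (f a) (s a) (l a)).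
Proof.
move=> esize_mu mu_esize mu_step h_mono hb pf ps pl.
have [qs hqs] := ptime_esize ps; have [ql hql] := ptime_esize pl.
(* [H] bounds the growth at all steps at once: an element of the list is no larger than the list,
   and [.+1] is the pair node of [(a, x)]. *)
pose H n := h ((n + n.+2 ^ ql).+1).
apply: (@ptime_foldl _ _ _ _ _ _ f s l
  (fun n => d * (n.+2 ^ qs + n.+2 ^ ql * H n))) => // [|a l1 l2 lE].
  do ![apply: poly_bounded_mul | apply: poly_bounded_add
      | apply: poly_bounded_const | by eexists; move=> n; apply: leqnn].
  apply: (poly_bounded_comp hb).
  apply: (@poly_bounded_le _ (fun n => 1 + (n + n.+2 ^ ql))) => //.
  do ![apply: poly_bounded_add | apply: poly_bounded_const
      | apply: poly_bounded_id | by eexists; move=> n; apply: leqnn].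
apply: leq_trans (esize_mu _) _; rewrite leq_mul2l; apply/orP; right.
have l_le := hql a.
have size_l1 : size l1 <= (esize a).+2 ^ ql.
  apply: leq_trans l_le; apply: leq_trans (size_le_esize _).
  by rewrite lE size_cat leq_addr.
apply: leq_trans (_ : mu (s a) + size l1 * H (esize a) <= _); last first.
  by rewrite leq_add ?leq_mul2r ?size_l1 ?orbT // (leq_trans (mu_esize _)).
elim/last_ind: l1 l2 lE {size_l1} => [|l1 x IH] l2 lE; first by rewrite mul0n addn0.
rewrite foldl_rcons size_rcons mulSn.
apply: leq_trans (mu_step _ _ _) _; rewrite [_ + (_ + _)]addnCA addnC.
apply: leq_add; last by apply: (IH (x :: l2)); rewrite lE cat_rcons.
apply: h_mono; rewrite esize_prod ltnS leq_add2l /=.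
apply: leq_trans l_le; rewrite lE cat_rcons esize_cat esize_cons.
have : 0 < esize l1 by apply: esize_gt0.
by lia.
Qed.

Lemma ptime_foldl_growth A S X {eA : encoding A} {eS : encoding S}
    {eX : encoding X} (h : nat -> nat)
    (f : A -> S -> X -> S) (s : A -> S) (l : A -> seq X) :
  (forall a y x, esize (f a y x) <= esize y + h (esize (a, x))) ->
  (forall n n', n <= n' -> h n <= h n') -> poly_bounded h ->
  ptime (fun p : A * S * X => f p.1.1 p.1.2 p.2) ->
  ptime s -> ptime l -> ptime (fun a => foldl (f a) (s a) (l a)).
Proof.
by apply: (@ptime_foldl_measure _ _ _ _ _ _ (fun y => esize y) 1) => y;
  rewrite ?mul1n.
Qed.

(** * Operations on pairs, lists and unary numbers *)

Lemma ptime_fst A B D {eA : encoding A} {eB : encoding B} {eD : encoding D}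
    (f : A -> B * D) : ptime f -> ptime (fun a => (f a).1).
Proof.
apply: (@ptime_comp _ _ _ _ _ _ fst).
apply: (@ptime_expr _ _ _ _ (EHd (EVar 0)) 2) => [st x /= -> //|st /=].
by move: (tsize_left (st 0)); lia.
Qed.

Lemma ptime_snd A B D {eA : encoding A} {eB : encoding B} {eD : encoding D}
    (f : A -> B * D) : ptime f -> ptime (fun a => (f a).2).
Proof.
apply: (@ptime_comp _ _ _ _ _ _ snd).
apply: (@ptime_expr _ _ _ _ (ETl (EVar 0)) 2) => [st x /= -> //|st /=].
by move: (tsize_right (st 0)); lia.
Qed.

Lemma ptime_cons A X {eA : encoding A} {eX : encoding X}
    (x : A -> X) (l : A -> seq X) :
  ptime x -> ptime l -> ptime (fun a => x a :: l a).
Proof. by move=> px pl; apply: ptime_recode (ptime_pair px pl). Qed.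

Lemma ptime_behead A X {eA : encoding A} {eX : encoding X} (l : A -> seq X) :
  ptime l -> ptime (fun a => behead (l a)).
Proof.
apply: (@ptime_comp _ _ _ _ _ _ behead).
apply: (@ptime_expr _ _ _ _ (ETl (EVar 0)) 2) => [st [|x s] /= -> //|st /=].
by move: (tsize_right (st 0)); lia.
Qed.

(** The machine returns [Leaf] as the head of [Leaf], so a default encoded as [Leaf] needs no test
    for emptiness. *)
Lemma ptime_head A X {eA : encoding A} {eX : encoding X} (x0 : X)
    (l : A -> seq X) :
  encode x0 = Leaf -> ptime l -> ptime (fun a => head x0 (l a)).
Proof.
move=> x0E; apply: (@ptime_comp _ _ _ _ _ _ (head x0)).
apply: (@ptime_expr _ _ _ _ (EHd (EVar 0)) 2) => [st [|x s] /= -> //=|st /=].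
by move: (tsize_left (st 0)); lia.
Qed.

Lemma ptime_odflt A X {eA : encoding A} {eX : encoding X} (x0 : X)
    (o : A -> option X) :
  encode x0 = Leaf -> ptime o -> ptime (fun a => odflt x0 (o a)).
Proof.
move=> x0E; apply: (@ptime_comp _ _ _ _ _ _ (odflt x0)).
apply: (@ptime_expr _ _ _ _ (ETl (EVar 0)) 2) => [st [x|] /= -> //=|st /=].
by move: (tsize_right (st 0)); lia.
Qed.

Lemma tsize_tbool c : tsize (tbool c) <= 3.
Proof. by case: c. Qed.

Lemma ptime_nilp A X {eA : encoding A} {eX : encoding X} (l : A -> seq X) :
  ptime l -> ptime (fun a => nilp (l a)).
Proof.
apply: (@ptime_comp _ _ _ _ _ _ (@nilp X)).
apply: (@ptime_expr _ _ _ _ (EEq (EVar 0) (EConst Leaf)) 4).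
  by move=> st [|x s] /= ->.
by move=> st /=; move: (tsize_tbool (teq (st 0) Leaf)); lia.
Qed.

Lemma teq_encode_nat (m n : nat) : teq (encode m) (encode n) = (m == n).
Proof. by elim: m n => [|m IH] [|n] //=; rewrite eqSS -IH. Qed.

Lemma ptime_eqn A {eA : encoding A} (m n : A -> nat) :
  ptime m -> ptime n -> ptime (fun a => m a == n a).
Proof.
move=> pm pn.
apply: (@ptime_comp _ _ _ _ _ _ (fun p : nat * nat => p.1 == p.2) _ _
  (ptime_pair pm pn)).
apply: (@ptime_expr _ _ _ _ (EEq (EHd (EVar 0)) (ETl (EVar 0))) 4).
  by move=> st [x y] /= -> /=; rewrite teq_encode_nat.
move=> st /=; move: (tsize_left (st 0)) (tsize_right (st 0)).
by move: (tsize_tbool (teq (left_tree (st 0)) (right_tree (st 0)))); lia.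
Qed.

Lemma ptime_succn A {eA : encoding A} (n : A -> nat) :
  ptime n -> ptime (fun a => (n a).+1).
Proof.
move=> pn.
by apply: ptime_recode (ptime_pair (ptime_const tt) pn).
Qed.

(** A unary number and a list of that many units are the same tree. This turns counting loops into
    folds over lists. *)
Lemma ptime_nseq_tt A {eA : encoding A} (n : A -> nat) :
  ptime n -> ptime (fun a => nseq (n a) tt).
Proof.
apply: ptime_recode => a; elim: (n a) => // k IH.
by rewrite -[LHS]/(Node Leaf (encode k)) IH.
Qed.

Lemma ptime_negb A {eA : encoding A} (c : A -> bool) :
  ptime c -> ptime (fun a => ~~ c a).
Proof.
move=> pc; apply: (@ptime_ext _ _ _ _ (fun a => if c a then false else true)) => //.
by apply: ptime_if => //; apply: ptime_const.
Qed.

Lemma ptime_andb A {eA : encoding A} (c d : A -> bool) :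
  ptime c -> ptime d -> ptime (fun a => c a && d a).
Proof.
move=> pc pd; apply: (@ptime_ext _ _ _ _ (fun a => if c a then d a else false)) => //.
by apply: ptime_if => //; apply: ptime_const.
Qed.

Lemma ptime_orb A {eA : encoding A} (c d : A -> bool) :
  ptime c -> ptime d -> ptime (fun a => c a || d a).
Proof.
move=> pc pd; apply: (@ptime_ext _ _ _ _ (fun a => if c a then true else d a)) => //.
by apply: ptime_if => //; apply: ptime_const.
Qed.

Lemma ptime_addb A {eA : encoding A} (c d : A -> bool) :
  ptime c -> ptime d -> ptime (fun a => c a (+) d a).
Proof.
move=> pc pd; apply: (@ptime_ext _ _ _ _ (fun a => if c a then ~~ d a else d a)).
  by move=> a; case: (c a).
by apply: ptime_if => //; apply: ptime_negb.
Qed.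

Ltac ptime_step :=
  cbv beta;
  first [ eassumption | refine (@ptime_id _ _) | refine (@ptime_const _ _ _ _ _)
        | refine (ptime_fst _) | refine (ptime_snd _) | refine (ptime_pair _ _)
        | refine (ptime_cons _ _) | refine (ptime_behead _)
        | refine (ptime_eqn _ _) | refine (ptime_succn _)
        | refine (ptime_nseq_tt _)
        | refine (ptime_negb _) | refine (ptime_andb _ _)
        | refine (ptime_orb _ _) | refine (ptime_addb _ _)
        | refine (ptime_nilp _) | refine (ptime_if _ _ _)
        | (refine (ptime_head _ _); [reflexivity|])
        | (refine (ptime_odflt _ _); [reflexivity|]) ].

Lemma poly_bounded_pow q : poly_bounded (fun n => n.+2 ^ q).
Proof. by exists q. Qed.

Ltac poly_step :=
  first [ apply: poly_bounded_add | apply: poly_bounded_mul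
        | apply: poly_bounded_id | apply: poly_bounded_const
        | apply: poly_bounded_pow ].

Lemma ptime_rev A X {eA : encoding A} {eX : encoding X} (l : A -> seq X) :
  ptime l -> ptime (fun a => rev (l a)).
Proof.
move=> pl.
apply: (@ptime_ext _ _ _ _ (fun a => foldl (fun s x => x :: s) [::] (l a))).
  move=> a; rewrite -[in LHS](revK (l a)) foldl_rev.
  by elim: (rev (l a)) => //= x s ->.
apply: (@ptime_foldl_growth _ _ _ _ _ _ S _ _ l) => //.
- by move=> a y x; rewrite esize_cons esize_prod /=; lia.
- by apply: poly_bounded_add (poly_bounded_const 1) poly_bounded_id.
- by do !ptime_step.
- exact: ptime_const.
Qed.

(** Adapts a function of the parameter and the element to a fold step, which also receives the
    state. *)
Lemma ptime_skip A S X Y {eA : encoding A} {eS : encoding S} {eX : encoding X}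
    {eY : encoding Y} (f : A -> X -> Y) :
  ptime (fun p : A * X => f p.1 p.2) ->
  ptime (fun p : A * S * X => f p.1.1 p.2).
Proof.
move=> pf.
apply: (@ptime_comp _ _ _ _ _ _ (fun p : A * X => f p.1 p.2)
  (fun p : A * S * X => (p.1.1, p.2))) => //.
by do !ptime_step.
Qed.

Lemma ptime_map A X Y {eA : encoding A} {eX : encoding X} {eY : encoding Y}
    (f : A -> X -> Y) (l : A -> seq X) :
  ptime (fun p : A * X => f p.1 p.2) -> ptime l ->
  ptime (fun a => map (f a) (l a)).
Proof.
move=> pf pl; have [q hq] := ptime_esize pf.
apply: (@ptime_ext _ _ _ _
  (fun a => rev (foldl (fun s x => f a x :: s) [::] (l a)))).
  move=> a; rewrite -[RHS]revK; congr rev.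
  by elim/last_ind: (l a) => // s x IH; rewrite foldl_rcons map_rcons rev_rcons IH.
apply: ptime_rev.
apply: (@ptime_foldl_growth _ _ _ _ _ _ (fun n => 1 + n.+2 ^ q)
  (fun a s x => f a x :: s)) => //.
- by move=> a y x; rewrite esize_cons; move: (hq (a, x)) => /=; lia.
- by move=> n n' nn'; rewrite leq_add2l leq_expn2.
- by do !poly_step.
- apply: ptime_cons; last by do !ptime_step.
  exact: ptime_skip.
- exact: ptime_const.
Qed.

Lemma ptime_filter A X {eA : encoding A} {eX : encoding X}
    (p : A -> X -> bool) (l : A -> seq X) :
  ptime (fun q : A * X => p q.1 q.2) -> ptime l ->
  ptime (fun a => filter (p a) (l a)).
Proof.
move=> pp pl.
apply: (@ptime_ext _ _ _ _
  (fun a => rev (foldl (fun s x => if p a x then x :: s else s) [::] (l a)))).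
  move=> a; rewrite -[RHS]revK; congr rev.
  elim/last_ind: (l a) => // s x IH; rewrite foldl_rcons filter_rcons IH.
  by case: (p a x); rewrite ?rev_rcons.
apply: ptime_rev.
apply: (@ptime_foldl_growth _ _ _ _ _ _ S
  (fun a s x => if p a x then x :: s else s)) => //.
- by move=> a y x; case: (p a x); rewrite ?esize_cons !esize_prod /=; lia.
- by apply: poly_bounded_add (poly_bounded_const 1) poly_bounded_id.
- apply: ptime_if; [|by do !ptime_step..].
  exact: ptime_skip.
- exact: ptime_const.
Qed.

Lemma ptime_has A X {eA : encoding A} {eX : encoding X}
    (p : A -> X -> bool) (l : A -> seq X) :
  ptime (fun q : A * X => p q.1 q.2) -> ptime l ->
  ptime (fun a => has (p a) (l a)).
Proof.
move=> pp pl.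
apply: (@ptime_ext _ _ _ _ (fun a => ~~ nilp (filter (p a) (l a)))).
  by move=> a; rewrite has_count -size_filter lt0n.
by apply: ptime_negb; apply: ptime_nilp; apply: ptime_filter.
Qed.

Lemma ptime_all A X {eA : encoding A} {eX : encoding X}
    (p : A -> X -> bool) (l : A -> seq X) :
  ptime (fun q : A * X => p q.1 q.2) -> ptime l ->
  ptime (fun a => all (p a) (l a)).
Proof.
move=> pp pl.
apply: (@ptime_ext _ _ _ _ (fun a => ~~ has (fun x => ~~ p a x) (l a))).
  by move=> a; rewrite -all_predC; apply: eq_all => x /=; rewrite negbK.
by apply: ptime_negb; apply: ptime_has => //; apply: ptime_negb.
Qed.

Lemma ptime_cat A X {eA : encoding A} {eX : encoding X} (l1 l2 : A -> seq X) :
  ptime l1 -> ptime l2 -> ptime (fun a => l1 a ++ l2 a).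
Proof.
move=> p1 p2.
apply: (@ptime_ext _ _ _ _
  (fun a => foldl (fun s x => x :: s) (l2 a) (rev (l1 a)))).
  by move=> a; rewrite foldl_rev; elim: (l1 a) => //= x s ->.
apply: (@ptime_foldl_growth _ _ _ _ _ _ S (fun _ s x => x :: s)) => //.
- by move=> a y x; rewrite esize_cons esize_prod /=; lia.
- by apply: poly_bounded_add (poly_bounded_const 1) poly_bounded_id.
- by do !ptime_step.
- exact: ptime_rev.
Qed.

Lemma ptime_flatten A X {eA : encoding A} {eX : encoding X}
    (l : A -> seq (seq X)) :
  ptime l -> ptime (fun a => flatten (l a)).
Proof.
move=> pl.
apply: (@ptime_ext _ _ _ _ (fun a => foldl cat [::] (l a))).
  move=> a; elim/last_ind: (l a) => // s x IH.
  by rewrite foldl_rcons IH flatten_rcons.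
apply: (@ptime_foldl_growth _ _ _ _ _ _ id (fun _ s x => s ++ x)) => //.
- by move=> a y x; rewrite esize_cat esize_prod /=; lia.
- exact: poly_bounded_id.
- by apply: ptime_cat; do !ptime_step.
- exact: ptime_const.
Qed.

Lemma ptime_size A X {eA : encoding A} {eX : encoding X} (l : A -> seq X) :
  ptime l -> ptime (fun a => size (l a)).
Proof.
move=> pl.
apply: (@ptime_ext _ _ _ _ (fun a => foldl (fun n _ => n.+1) 0 (l a))).
  by move=> a; elim/last_ind: (l a) => // s x IH; rewrite foldl_rcons IH size_rcons.
apply: (@ptime_foldl_growth _ _ _ _ _ _ (fun=> 2) (fun _ s _ => s.+1)) => //.
- by move=> a y x; rewrite addn2.
- exact: poly_bounded_const.
- by do !ptime_step.
- exact: ptime_const.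
Qed.

Lemma ptime_drop A X {eA : encoding A} {eX : encoding X}
    (i : A -> nat) (l : A -> seq X) :
  ptime i -> ptime l -> ptime (fun a => drop (i a) (l a)).
Proof.
move=> pi pl.
apply: (@ptime_ext _ _ _ _
  (fun a => foldl (fun s _ => behead s) (l a) (nseq (i a) tt))).
  move=> a; elim: (i a) (l a) => [|n IH] s /=; first by rewrite drop0.
  by rewrite IH; case: s.
apply: (@ptime_foldl_growth _ _ _ _ _ _ (fun=> 0) (fun _ s _ => behead s)) => //.
- by move=> a y x; rewrite addn0 esize_behead.
- exact: poly_bounded_const.
- by do !ptime_step.
- exact: ptime_nseq_tt.
Qed.

Lemma ptime_nth A X {eA : encoding A} {eX : encoding X} (x0 : X)
    (l : A -> seq X) (i : A -> nat) :
  encode x0 = Leaf -> ptime l -> ptime i -> ptime (fun a => nth x0 (l a) (i a)).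
Proof.
move=> x0E pl pi.
apply: (@ptime_ext _ _ _ _ (fun a => head x0 (drop (i a) (l a)))).
  by move=> a; rewrite -nth0 nth_drop addn0.
by apply: ptime_head => //; apply: ptime_drop.
Qed.

(** Truncated subtraction in unary: dropping [n] elements from a list of length [m] empties it
    exactly when [m <= n]. *)
Lemma ptime_leq A {eA : encoding A} (m n : A -> nat) :
  ptime m -> ptime n -> ptime (fun a => m a <= n a).
Proof.
move=> pm pn.
apply: (@ptime_ext _ _ _ _ (fun a => nilp (drop (n a) (nseq (m a) tt)))).
  by move=> a; rewrite /nilp size_drop size_nseq.
by apply: ptime_nilp; apply: ptime_drop => //; apply: ptime_nseq_tt.
Qed.

Lemma esize_nat (n : nat) : esize n = n.*2.+1.
Proof. by elim: n => // n; rewrite /esize /= doubleS => <-. Qed.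

Lemma esize_seq_le X {eX : encoding X} (l : seq X) b :
  (forall i, i < size l -> forall x0, esize (nth x0 l i) <= b) ->
  esize l <= size l * b.+1 + 1.
Proof.
elim: l => // x l IH H.
have x_le : esize x <= b by apply: (H 0 _ x).
have l_le : esize l <= size l * b.+1 + 1 by apply: IH => i; apply: (H i.+1).
by rewrite esize_cons -[size (x :: l)]/(size l).+1 mulSn; lia.
Qed.

(** The counter is the length of the accumulator, so the growth of one step depends on the state and
    the growth criterion does not apply. The states are bounded directly, by the number of entries
    times the unary size of the largest. *)
Lemma ptime_iota A {eA : encoding A} (n : A -> nat) :
  ptime n -> ptime (fun a => iota 0 (n a)).
Proof.
move=> pn; have [q hq] := ptime_esize pn.
have iotaE (l : seq unit) :
    foldl (fun s _ => size s :: s) [::] l = rev (iota 0 (size l)).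
  elim/last_ind: l => // l x IH.
  by rewrite foldl_rcons IH size_rcons size_rev size_iota -addn1 iotaD rev_cat.
apply: (@ptime_ext _ _ _ _
  (fun a => rev (foldl (fun s _ => size s :: s) [::] (nseq (n a) tt)))).
  by move=> a; rewrite iotaE size_nseq revK.
apply: ptime_rev.
apply: (@ptime_foldl _ _ _ _ _ _ (fun _ s _ => size s :: s) _ _
  (fun k => k.+2 ^ q * (1 + k.+2 ^ q) + 1)) => [|a l1 l2 lE|||].
- by do !poly_step.
- have size_l1 : (size l1).*2.+1 <= (esize a).+2 ^ q.
    apply: leq_trans (hq a); rewrite esize_nat -[n a](size_nseq (n a) tt) lE.
    by rewrite size_cat; lia.
  rewrite iotaE esize_rev.
  apply: leq_trans (@esize_seq_le _ _ _ ((esize a).+2 ^ q) _) _.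
    move=> i; rewrite size_iota => il x0; rewrite nth_iota // esize_nat add0n.
    by apply: leq_trans size_l1; rewrite ltnS leq_double ltnW.
  rewrite size_iota leq_add2r add1n; apply: leq_mul => //.
  by apply: leq_trans size_l1; lia.
- by apply: ptime_cons; do ?apply: ptime_size; do !ptime_step.
- exact: ptime_const.
- exact: ptime_nseq_tt.
Qed.

(** * Binary addition and comparison *)

Fixpoint bits_val (s : seq bool) : nat :=
  if s is c :: s' then c + (bits_val s').*2 else 0.

(** One step of a ripple-carry adder. The state holds the remaining digits of both terms, the carry
    and the digits written, latest first. The conditional is the majority of the two digits and the
    carry; [head false] pads the shorter term with zeros. *)
Definition add_step (t : seq bool * seq bool * bool * seq bool) :
    seq bool * seq bool * bool * seq bool :=
  (behead t.1.1.1, behead t.1.1.2,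
   if t.1.2 then head false t.1.1.1 || head false t.1.1.2
            else head false t.1.1.1 && head false t.1.1.2,
   (head false t.1.1.1 (+) head false t.1.1.2) (+) t.1.2 :: t.2).

(* The digits come out in reverse order.  The number of digits of a sum is not
   kept minimal: it is the total number of digits of the terms, plus one. *)
Definition bits_add (x y : seq bool) : seq bool :=
  let t := foldl (fun t _ => add_step t) (x, y, false, [::]) (x ++ y) in
  rev (t.1.2 :: t.2).

Lemma bits_val_cat x y : bits_val (x ++ y) = bits_val x + bits_val y * 2 ^ size x.
Proof.
elim: x => [|c x IH] /=; first by rewrite expn0 muln1.
by rewrite IH expnS; move: (2 ^ _) => p; nia.
Qed.

Lemma bits_val_head s : bits_val s = head false s + (bits_val (behead s)).*2.
Proof. by case: s. Qed.

Lemma foldl_const (S X : Type) (f : S -> S) s (l : seq X) :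
  foldl (fun s _ => f s) s l = iter (size l) f s.
Proof. by elim: l s => //= x l IH s; rewrite IH -iterSr. Qed.

(** The invariant of the adder: what is written, plus the carry and the unread parts shifted by the
    number of digits written, keeps its value. *)
Lemma iter_add_step n x y c out :
  let t := iter n add_step (x, y, c, out) in
  [/\ t.1.1 = (drop n x, drop n y), size t.2 = n + size out &
      bits_val (rev t.2) + (t.1.2 + bits_val t.1.1.1 + bits_val t.1.1.2)
        * 2 ^ size t.2 =
      bits_val (rev out) + (c + bits_val x + bits_val y) * 2 ^ size out].
Proof.
elim: n => [|n [IH1 IH2 IH3]]; first by rewrite !drop0.
rewrite iterS; move: (iter n _ _) IH1 IH2 IH3 => [[[x' y'] c'] out'] /= [-> ->].
move=> szE <-; split.
- by rewrite -!drop1 !drop_drop !add1n.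
- by rewrite szE.
rewrite rev_cons -cats1 bits_val_cat size_rev /= expnS.
rewrite [bits_val (drop n x)]bits_val_head [bits_val (drop n y)]bits_val_head.
move: (bits_val (behead _)) (bits_val (behead _)) => u v.
move: (head _ _) (head _ _) => d e; move: (2 ^ size out') => p.
by case: c' d e => [] [] [] /=; rewrite -?muln2; nia.
Qed.

Lemma bits_add_val x y : bits_val (bits_add x y) = bits_val x + bits_val y.
Proof.
rewrite /bits_add foldl_const.
have [] := iter_add_step (size (x ++ y)) x y false [::].
move: (iter _ _ _) => [[[x' y'] c] out] /= [-> ->] _.
have -> : drop (size (x ++ y)) x = [::] by rewrite drop_oversize // size_cat leq_addr.
have -> : drop (size (x ++ y)) y = [::] by rewrite drop_oversize // size_cat leq_addl.
rewrite expn0 muln1 add0n => <- /=.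
by rewrite rev_cons -cats1 bits_val_cat size_rev /= double0 !addn0.
Qed.

Lemma size_bits_add x y : size (bits_add x y) = (size x + size y).+1.
Proof.
rewrite /bits_add foldl_const /= size_rev /=.
by have [_ -> _] := iter_add_step (size (x ++ y)) x y false [::]; rewrite size_cat addn0.
Qed.

(** Digits arrive with the least significant first, so a later difference overrides the verdict
    reached so far, and equal digits leave it unchanged. *)
Definition leq_step (t : seq bool * seq bool * bool) : seq bool * seq bool * bool :=
  (behead t.1.1, behead t.1.2,
   if head false t.1.1 (+) head false t.1.2 then head false t.1.2 else t.2).

Definition bits_leq (x y : seq bool) : bool :=
  (foldl (fun t _ => leq_step t) (x, y, true) (x ++ y)).2.

(** The flag [c] is the verdict on the digits already read; it only decides when the unread parts
    have equal values. *)
Lemma iter_leq_step n x y c :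
  size x <= n -> size y <= n ->
  (iter n leq_step (x, y, c)).2 =
  if c then bits_val x <= bits_val y else bits_val x < bits_val y.
Proof.
elim: n x y c => [|n IH] x y c.
  by rewrite !leqn0 => /nilP-> /nilP->; case: c.
move=> xn yn; rewrite iterSr IH /=; try by rewrite size_behead; lia.
rewrite (bits_val_head x) (bits_val_head y).
move: (bits_val (behead x)) (bits_val (behead y)) (head _ _) (head _ _) => u v d e.
by case: c d e => [] [] [] /=; lia.
Qed.

Lemma bits_leqE x y : bits_leq x y = (bits_val x <= bits_val y).
Proof.
by rewrite /bits_leq foldl_const iter_leq_step // size_cat ?leq_addr ?leq_addl.
Qed.

Lemma ptime_bits_add A {eA : encoding A} (x y : A -> seq bool) :
  ptime x -> ptime y -> ptime (fun a => bits_add (x a) (y a)).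
Proof.
move=> px py.
apply: (@ptime_comp _ _ _ _ _ _ (fun t : seq bool * seq bool * bool * seq bool =>
  rev (t.1.2 :: t.2)) (fun a => foldl (fun t _ => add_step t)
    (x a, y a, false, [::]) (x a ++ y a))).
  by apply: ptime_rev; do !ptime_step.
apply: (@ptime_foldl_growth _ _ _ _ _ _ (fun=> 9) (fun _ t _ => add_step t)) => //.
- move=> _ [[[u v] c] out] _; rewrite /add_step !(esize_prod, esize_cons) /=.
  have uv_le := (esize_behead u, esize_behead v).
  set c1 := if c then _ else _; set c2 := _ (+) c.
  have c1_le := esize_bool c1; have c2_le := esize_bool c2.
  by move: uv_le => [u_le v_le]; lia.
- exact: poly_bounded_const.
- by rewrite /add_step; do !ptime_step.
- by do !ptime_step.
- exact: ptime_cat.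
Qed.

Lemma ptime_bits_leq A {eA : encoding A} (x y : A -> seq bool) :
  ptime x -> ptime y -> ptime (fun a => bits_leq (x a) (y a)).
Proof.
move=> px py; apply: ptime_snd.
apply: (@ptime_foldl_growth _ _ _ _ _ _ (fun=> 3) (fun _ t _ => leq_step t)) => //.
- move=> _ [[u v] c] _; rewrite /leq_step !esize_prod /=.
  have uv_le := (esize_behead u, esize_behead v).
  set c1 := if _ then _ else _.
  have c1_le := esize_bool c1.
  by move: uv_le => [u_le v_le]; lia.
- exact: poly_bounded_const.
- by rewrite /leq_step; do !ptime_step.
- by do !ptime_step.
- exact: ptime_cat.
Qed.

(** The encoded size is a poor measure here, since a digit 1 is a larger tree than a digit 0 and an
    addition may change all digits. The number of digits plus one is exactly additive under
    [bits_add] and determines the size up to a factor. *)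
Lemma ptime_bits_sum A {eA : encoding A} (l : A -> seq (seq bool)) :
  ptime l -> ptime (fun a => foldl bits_add [::] (l a)).
Proof.
move=> pl.
have esize_bits_le (y : seq bool) : esize y <= 5 * (size y).+1.
  elim: y => // c y IH; rewrite esize_cons /=.
  by have := esize_bool c; move: IH; lia.
have size_lt (y : seq bool) : size y < esize y.
  by elim: y => // c y IH; rewrite esize_cons /=; lia.
apply: (@ptime_foldl_measure _ _ _ _ _ _ (fun y => (size y).+1) 5 id
  (fun _ => bits_add)) => //.
- by move=> a y x; rewrite size_bits_add esize_prod /=; move: (size_lt x); lia.
- exact: poly_bounded_id.
- by apply: ptime_bits_add; do !ptime_step.
- exact: ptime_const.
Qed.

(** * Exhaustive search *)

(* The adjacency matrix, the characteristic vector of the source and the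
   weights, nested as in [enc_instance]. *)
Notation raw_instance :=
  (seq (seq bool) * (seq bool * (seq (option (seq bool)) * unit)))%type.

Definition vertices (G : raw_instance) : seq nat := iota 0 (size G.1).
Definition adj (G : raw_instance) (u v : nat) : bool := nth false (nth [::] G.1 u) v.
Definition weight_bits (G : raw_instance) (v : nat) : seq bool :=
  odflt [::] (nth None G.2.2.1 v).

Definition mem_nat (B : seq nat) (v : nat) : bool := has (fun u => u == v) B.
Definition plays (c : seq (nat * nat)) (v i : nat) : bool :=
  has (fun p => (p.1 == v) && (p.2 == i)) c.
Definition shielded (c : seq (nat * nat)) (t v : nat) : bool :=
  has (fun p => (p.1 == v) && (p.2.+1 <= t)) c.

(** [B] is the set burned at time [t] and the result the one at time [t.+1]; [1 <= t] reflects that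
    the fire rests between times 0 and 1. *)
Definition burn_step (G : raw_instance) c (B : seq nat) (t : nat) : seq nat :=
  [seq v <- vertices G | mem_nat B v ||
    [&& 1 <= t, ~~ shielded c t v & has (fun u => adj G u v) B]].
Definition burn (G : raw_instance) c (t : nat) : seq nat :=
  foldl (burn_step G c) [seq v <- vertices G | nth false G.2.1 v] (iota 0 t).

Definition legal (b : nat) (G : raw_instance) (c : seq (nat * nat)) : bool :=
  all (fun p => ~~ mem_nat (burn G c p.2.+1) p.1) c &&
  all (fun i => size [seq v <- vertices G | plays c v i] <= b) (vertices G).

Definition value (G : raw_instance) (c : seq (nat * nat)) : seq bool :=
  foldl bits_add [::]
    [seq weight_bits G v | v <- vertices G & ~~ mem_nat (burn G c (size G.1)) v].

Definition pairs (G : raw_instance) : seq (nat * nat) :=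
  flatten [seq [seq (v, i) | i <- vertices G] | v <- vertices G].

Definition extend (G : raw_instance) (cs : seq (seq (nat * nat))) :
    seq (seq (nat * nat)) :=
  cs ++ flatten [seq [seq p :: c | p <- pairs G] | c <- cs].

(** All lists of at most [D] pairs, with repetitions and in every order; this is harmless, since a
    list only stands for the set of its pairs. *)
Definition candidates (D : nat) (G : raw_instance) : seq (seq (nat * nat)) :=
  iter D (extend G) [:: [::]].

Definition best (b D : nat) (G : raw_instance) : seq (nat * nat) :=
  foldl (fun c c' => if legal b G c' && bits_leq (value G c) (value G c')
                     then c' else c) [::] (candidates D G).

Definition strategy_matrix (G : raw_instance) (c : seq (nat * nat)) :
    seq (seq bool) :=
  [seq [seq plays c v i | i <- vertices G] | v <- vertices G].

Definition solve (b D : nat) (G : raw_instance) : seq (seq bool) :=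
  strategy_matrix G (best b D G).

(** * The search runs in polynomial time *)

Lemma ptime_vertices A {eA : encoding A} (G : A -> raw_instance) :
  ptime G -> ptime (fun a => vertices (G a)).
Proof. by move=> pG; apply: ptime_iota; apply: ptime_size; do !ptime_step. Qed.

Lemma ptime_adj A {eA : encoding A} (G : A -> raw_instance) (u v : A -> nat) :
  ptime G -> ptime u -> ptime v -> ptime (fun a => adj (G a) (u a) (v a)).
Proof.
by move=> pG pu pv; do 2!apply: ptime_nth => //; do !ptime_step.
Qed.

Lemma ptime_weight_bits A {eA : encoding A} (G : A -> raw_instance) (v : A -> nat) :
  ptime G -> ptime v -> ptime (fun a => weight_bits (G a) (v a)).
Proof.
move=> pG pv; apply: ptime_odflt => //; apply: ptime_nth => //.
by do !ptime_step.
Qed.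

Lemma ptime_mem_nat A {eA : encoding A} (B : A -> seq nat) (v : A -> nat) :
  ptime B -> ptime v -> ptime (fun a => mem_nat (B a) (v a)).
Proof.
move=> pB pv; apply: (@ptime_has _ _ _ _ (fun a u => u == v a)) => //.
apply: ptime_eqn; first by do !ptime_step.
by apply: (ptime_comp pv); do !ptime_step.
Qed.

Lemma ptime_plays A {eA : encoding A} (c : A -> seq (nat * nat)) (v i : A -> nat) :
  ptime c -> ptime v -> ptime i -> ptime (fun a => plays (c a) (v a) (i a)).
Proof.
move=> pc pv pi.
apply: (@ptime_has _ _ _ _ (fun a p => (p.1 == v a) && (p.2 == i a))) => //.
apply: ptime_andb; apply: ptime_eqn; try by do !ptime_step.
- by apply: (ptime_comp pv); do !ptime_step.
- by apply: (ptime_comp pi); do !ptime_step.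
Qed.

Lemma ptime_shielded A {eA : encoding A} (c : A -> seq (nat * nat)) (t v : A -> nat) :
  ptime c -> ptime t -> ptime v -> ptime (fun a => shielded (c a) (t a) (v a)).
Proof.
move=> pc pt pv.
apply: (@ptime_has _ _ _ _ (fun a p => (p.1 == v a) && (p.2.+1 <= t a))) => //.
apply: ptime_andb; [apply: ptime_eqn | apply: ptime_leq]; try by do !ptime_step.
- by apply: (ptime_comp pv); do !ptime_step.
- by apply: (ptime_comp pt); do !ptime_step.
Qed.

Lemma ptime_burn_step A {eA : encoding A} (G : A -> raw_instance)
    (c : A -> seq (nat * nat)) (B : A -> seq nat) (t : A -> nat) :
  ptime G -> ptime c -> ptime B -> ptime t ->
  ptime (fun a => burn_step (G a) (c a) (B a) (t a)).
Proof.
move=> pG pc pB pt.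
have fstP D (eD : encoding D) (f : A -> D) :
    ptime f -> ptime (fun q : A * nat => f q.1).
  by move=> pf; apply: (ptime_comp pf); do !ptime_step.
apply: (@ptime_filter _ _ _ _ (fun a v => mem_nat (B a) v ||
  [&& 1 <= t a, ~~ shielded (c a) (t a) v & has (fun u => adj (G a) u v) (B a)]));
  last exact: ptime_vertices.
apply: ptime_orb; first by apply: ptime_mem_nat; [apply: fstP | do !ptime_step].
apply: ptime_andb; first by apply: ptime_leq; [exact: ptime_const | apply: fstP].
apply: ptime_andb.
  apply: ptime_negb; apply: ptime_shielded; [exact: fstP | exact: fstP |].
  by do !ptime_step.
apply: (@ptime_has _ _ _ _ (fun (q : A * nat) u => adj (G q.1) u q.2)); last exact: fstP.
apply: ptime_adj; [|by do !ptime_step..].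
by apply: (ptime_comp pG); do !ptime_step.
Qed.

(** Each step returns a sublist of the vertices, so no state outgrows the vertex list, however many
    steps are made. *)
Lemma ptime_burn A {eA : encoding A} (G : A -> raw_instance)
    (c : A -> seq (nat * nat)) (t : A -> nat) :
  ptime G -> ptime c -> ptime t -> ptime (fun a => burn (G a) (c a) (t a)).
Proof.
move=> pG pc pt; have [q hq] := ptime_esize (ptime_vertices pG).
apply: (@ptime_foldl_growth _ _ _ _ _ _ (fun n => n.+2 ^ q)
  (fun a => burn_step (G a) (c a))).
- move=> a y x; apply: leq_trans (esize_filter _ _) _.
  apply: leq_trans (hq a) _; apply: leq_trans (leq_addl _ _).
  by apply: leq_expn2; rewrite esize_prod /=; lia.
- by move=> n n' nn'; apply: leq_expn2.
- exact: poly_bounded_pow.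
- apply: ptime_burn_step; try by do !ptime_step.
  + by apply: (ptime_comp pG); do !ptime_step.
  + by apply: (ptime_comp pc); do !ptime_step.
- apply: (@ptime_filter _ _ _ _ (fun a v => nth false (G a).2.1 v));
    last exact: ptime_vertices.
  apply: ptime_nth => //; last by do !ptime_step.
  by do 2!ptime_step; apply: (ptime_comp pG); do !ptime_step.
- exact: ptime_iota.
Qed.

Lemma ptime_legal A {eA : encoding A} b (G : A -> raw_instance)
    (c : A -> seq (nat * nat)) :
  ptime G -> ptime c -> ptime (fun a => legal b (G a) (c a)).
Proof.
move=> pG pc; apply: ptime_andb.
- apply: (@ptime_all _ _ _ _
    (fun a p => ~~ mem_nat (burn (G a) (c a) p.2.+1) p.1)) => //.
  apply: ptime_negb; apply: ptime_mem_nat; last by do !ptime_step.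
  apply: ptime_burn; last by do !ptime_step.
  + by apply: (ptime_comp pG); do !ptime_step.
  + by apply: (ptime_comp pc); do !ptime_step.
- apply: (@ptime_all _ _ _ _
    (fun a i => size [seq v <- vertices (G a) | plays (c a) v i] <= b));
    last exact: ptime_vertices.
  apply: ptime_leq; last exact: ptime_const.
  apply: ptime_size.
  apply: (@ptime_filter _ _ _ _ (fun (q : A * nat) v => plays (c q.1) v q.2)).
    apply: ptime_plays; try by do !ptime_step.
    by apply: (ptime_comp pc); do !ptime_step.
  by apply: ptime_vertices; apply: (ptime_comp pG); do !ptime_step.
Qed.

Lemma ptime_value A {eA : encoding A} (G : A -> raw_instance)
    (c : A -> seq (nat * nat)) :
  ptime G -> ptime c -> ptime (fun a => value (G a) (c a)).
Proof.
move=> pG pc; apply: ptime_bits_sum.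
apply: (@ptime_map _ _ _ _ _ _ (fun a v => weight_bits (G a) v)).
  apply: ptime_weight_bits; last by do !ptime_step.
  by apply: (ptime_comp pG); do !ptime_step.
apply: (@ptime_filter _ _ _ _
  (fun a v => ~~ mem_nat (burn (G a) (c a) (size (G a).1)) v));
  last exact: ptime_vertices.
apply: ptime_negb; apply: ptime_mem_nat; last by do !ptime_step.
apply: (@ptime_comp _ _ _ _ _ _ (fun a => burn (G a) (c a) (size (G a).1)) fst);
  last by do !ptime_step.
by apply: ptime_burn => //; apply: ptime_size; do !ptime_step.
Qed.

Lemma ptime_pairs A {eA : encoding A} (G : A -> raw_instance) :
  ptime G -> ptime (fun a => pairs (G a)).
Proof.
move=> pG; apply: ptime_flatten.
apply: (@ptime_map _ _ _ _ _ _ (fun a v => [seq (v, i) | i <- vertices (G a)]));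
  last exact: ptime_vertices.
apply: (@ptime_map _ _ _ _ _ _ (fun (q : A * nat) i => (q.2, i))).
  by do !ptime_step.
by apply: ptime_vertices; apply: (ptime_comp pG); do !ptime_step.
Qed.

(** The rounds are composed outside the program, one polynomial-time round for each unit of [D]. The
    exponent depends on [D], so it matters that [D] is a constant and not part of the input. *)
Lemma ptime_candidates D : ptime (candidates D).
Proof.
elim: D => [|D IH]; first exact: ptime_const.
apply: ptime_cat => //; apply: ptime_flatten.
apply: (@ptime_map _ _ _ _ _ _ (fun G c => [seq p :: c | p <- pairs G])) => //.
apply: (@ptime_map _ _ _ _ _ _
  (fun (q : raw_instance * seq (nat * nat)) p => p :: q.2)).
  by do !ptime_step.
by apply: ptime_pairs; do !ptime_step.
Qed.

Lemma ptime_best b D : ptime (best b D).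
Proof.
apply: (@ptime_foldl_growth _ _ _ _ _ _ id (fun G c c' =>
  if legal b G c' && bits_leq (value G c) (value G c') then c' else c)) => //.
- by move=> a y x; case: ifP => _; rewrite esize_prod /=; lia.
- exact: poly_bounded_id.
- apply: ptime_if; [|by do !ptime_step..].
  apply: ptime_andb; first by apply: ptime_legal; do !ptime_step.
  by apply: ptime_bits_leq; apply: ptime_value; do !ptime_step.
- exact: ptime_const.
- exact: ptime_candidates.
Qed.

Lemma ptime_solve b D : ptime (solve b D).
Proof.
apply: (@ptime_comp _ _ _ _ _ _
  (fun q : raw_instance * seq (nat * nat) => strategy_matrix q.1 q.2)
  (fun G => (G, best b D G))); last first.
  by apply: ptime_pair; [exact: ptime_id | exact: ptime_best].
apply: (@ptime_map _ _ _ _ _ _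
  (fun (q : raw_instance * seq (nat * nat)) v =>
     [seq plays q.2 v i | i <- vertices q.1])); last first.
  by apply: ptime_vertices; do !ptime_step.
apply: (@ptime_map _ _ _ _ _ _
  (fun (q : raw_instance * seq (nat * nat) * nat) i => plays q.1.2 q.2 i)).
  by apply: ptime_plays; do !ptime_step.
by apply: ptime_vertices; do !ptime_step.
Qed.

(** An encoding has size [s >= 1], so [s.+2 <= 3 * s]; this gives the coefficient [3 ^ r]. *)
Lemma ptime_poly_time_solvable (I A B : Type) {eA : encoding A} {eB : encoding B}
    (enc : I -> tree) (dom : I -> Prop) (answer : I -> tree -> Prop)
    (raw : I -> A) (f : A -> B) :
  ptime f -> (forall x, enc x = encode (raw x)) ->
  (forall x, dom x -> answer x (encode (f (raw x)))) ->
  poly_time_solvable enc dom answer.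
Proof.
move=> [[C [m [r H]]]] encE ans; exists C, (3 ^ r), r => x dx.
have [st [t [ex tc [h _]]]] := H (raw x) (init_store (enc x)) (encE x).
exists st, t; split=> //; last by rewrite h; apply: ans.
apply: leq_trans tc _; rewrite -expnMn; apply: leq_expn2.
have : 0 < esize (raw x) by apply: esize_gt0.
by rewrite encE /esize; lia.
Qed.

(** * Simple paths and the end of the fire *)

Definition path_bound (T : eqType) (e : rel T) (B : nat) : Prop :=
  forall x p, path e x p -> uniq (x :: p) -> size p < B.

Lemma path_bound_card (T : finType) (e : rel T) : path_bound e #|T|.
Proof. by move=> x p _ /card_uniqP; rewrite /= => <-; apply: max_card. Qed.

Lemma path_bound_isomorphic (T U : eqType) (e : rel T) (f : rel U) B :
  isomorphic e f -> path_bound f B -> path_bound e B.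
Proof.
move=> [h /bij_inj h_inj eh] fB x p ep up.
rewrite -(size_map h); apply: (fB (h x)); last by rewrite -map_cons map_inj_uniq.
elim: p x ep {up} => //= y p IH x /andP[exy /IH->].
by rewrite -eh exy.
Qed.

(** Two adjacent vertices other than the center [None] lie on the same leg. *)
Lemma leg_path_same_leg m (len : 'I_m -> nat) a (q : seq (leg_vertex len)) :
  path (@leg_adj m len) (Some a) q -> None \notin q ->
  all (fun y : leg_vertex len => if y is Some b then tag b == tag a else false) q.
Proof.
elim: q a => //= - [b|] q IH a; last by rewrite inE.
rewrite inE => /andP[ab /IH bq] /bq {bq}.
have -> : tag b = tag a.
  by case/orP: ab => /andP[/eqP].
by rewrite eqxx.
Qed.

(** Away from the center the path stays on one leg, where a vertex is determined by its position, a
    number below [k]. *)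
Lemma leg_segment_size m (len : 'I_m -> nat) k (q : seq (leg_vertex len)) :
  (forall i, len i <= k) -> sorted (@leg_adj m len) q -> uniq q ->
  None \notin q -> size q <= k.
Proof.
move=> lenk; case: q => //= - [a|] q; last by rewrite inE.
rewrite [None \in _]inE => aq uq nq.
pose pos (y : leg_vertex len) : nat := if y is Some b then tagged b else 0.
have tagq : all (fun y : leg_vertex len =>
    if y is Some b then tag b == tag a else false) (Some a :: q).
  by rewrite /= eqxx leg_path_same_leg.
have pos_inj : {in Some a :: q &, injective pos}.
  move=> x y /(allP tagq); case: x => // x tx /(allP tagq); case: y => // y.
  move: tx; case: x y => [i x] [j y] /= /eqP ia /eqP ja.
  move: (etrans ia (esym ja)) => ij; case: j / ij y {ja} => y xy.
  by rewrite (ord_inj xy).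
rewrite -[(size q).+1]/(size (Some a :: q)) -(size_map pos) -(size_iota 0 k).
apply: uniq_leq_size; first by rewrite map_inj_in_uniq.
move=> _ /mapP[x /(allP tagq) + ->]; case: x => // - [i x] /= _.
by rewrite mem_iota add0n (leq_trans (ltn_ord x) (lenk _)).
Qed.

Lemma leg_path_bound m (len : 'I_m -> nat) k :
  (forall i, len i <= k) -> path_bound (@leg_adj m len) k.*2.+1.
Proof.
move=> lenk x p xp; move: xp; rewrite -[path _ _ _]/(sorted _ (x :: p)).
rewrite ltnS -ltnS -[(size p).+1]/(size (x :: p)); move: (x :: p) => q {x p}.
case: (boolP (None \in q)) => [/splitPr [q1 q2]|nq sq uq]; last first.
  by apply: leq_trans (leg_segment_size lenk sq uq nq) _; lia.
move=> sq; rewrite cat_uniq /= negb_or => /and3P[u1 /andP[n1 _] /andP[n2 u2]].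
have [s1 /path_sorted s2] := cat_sorted2 sq.
rewrite size_cat /=; apply: (@leq_trans (k + k.+1)); last by lia.
apply: leq_add; first exact: leg_segment_size lenk s1 u1 n1.
by rewrite ltnS; exact: leg_segment_size lenk s2 u2 n2.
Qed.

Lemma kstar_path_bound k (T : eqType) (e : rel T) :
  is_kstar k e -> path_bound e k.*2.+1.
Proof.
move=> [m [len [lenk iso]]].
by apply: path_bound_isomorphic iso (leg_path_bound _) => i; case/andP: (lenk i).
Qed.

(** * The course of the fire *)

Lemma protected_mono n (Phi : strategy n) t t' :
  t <= t' -> protected Phi t \subset protected Phi t'.
Proof.
move=> tt'; apply/subsetP=> v; rewrite !inE => /existsP[i /andP[it iP]].
by apply/existsP; exists i; rewrite (leq_trans it tt').
Qed.

Lemma protected_ever_protected n (Phi : strategy n) t v :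
  v \in protected Phi t -> ever_protected Phi v.
Proof. by rewrite inE => /existsP[i /andP[_ ?]]; apply/existsP; exists i. Qed.

Lemma in_burnedS n (e : rel 'I_n) s Phi t v :
  (v \in burned e s Phi t.+1) = (v \in burned e s Phi t) ||
    [&& 1 <= t, v \notin protected Phi t & [exists u in burned e s Phi t, e u v]].
Proof. by rewrite /= in_setU in_set. Qed.

Lemma burned_mono n (e : rel 'I_n) s Phi t t' :
  t <= t' -> burned e s Phi t \subset burned e s Phi t'.
Proof.
move=> /subnK <-; elim: (t' - t) => // d IH; apply: subset_trans IH _.
by rewrite addSn; apply: subsetUl.
Qed.

Lemma burned1 n (e : rel 'I_n) s Phi : burned e s Phi 1 = [set s].
Proof. by apply/setP=> v; rewrite in_burnedS orbF. Qed.

(* A vertex that catches fire at time [t.+2] was ignited by one that caught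
   fire exactly one step earlier, hence lies at the end of a simple path. *)
Lemma newly_burned_path n (e : rel 'I_n) s Phi t v :
  v \in burned e s Phi t.+2 -> v \notin burned e s Phi t.+1 ->
  exists p, [/\ path e s p, last s p = v, uniq (s :: p), size p = t.+1
              & {subset s :: p <= burned e s Phi t.+2}].
Proof.
elim: t v => [|t IH] v vt vNt.
  move: (vt); rewrite in_burnedS (negbTE vNt) orFb => /and3P[_ _ /exists_inP[u]].
  rewrite burned1 in_set1 => /eqP-> esv.
  move: vNt; rewrite burned1 in_set1 => sv.
  exists [:: v]; rewrite /= esv inE eq_sym sv; split=> // w.
  rewrite in_cons mem_seq1 => /orP[] /eqP-> //.
  by rewrite (subsetP (@burned_mono _ e s Phi 1 2 _)) // burned1 set11.
move: (vt); rewrite in_burnedS (negbTE vNt) orFb => /and3P[_ vP /exists_inP[u ut euv]].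
(* Had [u] burned one step earlier, it would have ignited [v] one step earlier too, as [v] was not
   protected then either. *)
have uNt : u \notin burned e s Phi t.+1.
  apply: contra vNt => uB; rewrite in_burnedS; apply/orP; right.
  apply/and3P; split=> //; last by apply/exists_inP; exists u.
  by apply: contra vP; apply: (subsetP (protected_mono _ _)).
have [p [pp pl pu ps pB]] := IH u ut uNt.
exists (rcons p v); rewrite rcons_path pp pl euv last_rcons size_rcons ps.
split=> //.
  rewrite -rcons_cons rcons_uniq pu andbT; apply: contra vNt; exact: pB.
move=> w; rewrite -rcons_cons mem_rcons inE => /orP[/eqP-> //|/pB].
exact: (subsetP (burned_mono _ _ _ _)).
Qed.

Lemma burned_stable n (e : rel 'I_n) s Phi B t :
  path_bound e B -> B <= t -> burned e s Phi t = burned e s Phi B.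
Proof.
move=> eB /subnK <-; elim: (t - B) => // d <-; rewrite addSn.
(* The one-vertex path at [s] gives [0 < B]. Time 0 must be excluded because [newly_burned_path]
   speaks of ignitions from time 2 on. *)
have [t' tE] : exists t', d + B = t'.+1.
  by exists (d + B).-1; have := eB s [::] isT isT; lia.
rewrite tE; apply/setP=> v.
case: (boolP (v \in burned e s Phi t'.+1)) => [|vN].
  by apply: (subsetP (burned_mono _ _ _ _)).
apply/negP => /newly_burned_path /(_ vN) [p [pp _ pu ps _]].
by have := eB s p pp pu; rewrite ps; lia.
Qed.

Lemma burned_sub_final n (e : rel 'I_n) s Phi t :
  burned e s Phi t \subset burned e s Phi n.
Proof.
have eB := @path_bound_card _ e; rewrite card_ord in eB.
case: (leqP t n) => [/burned_mono //|/ltnW nt].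
by rewrite (burned_stable _ _ eB nt).
Qed.

(** Up to the time of protection this is validity; afterwards the protection blocks the fire. *)
Lemma protected_not_burned n b (e : rel 'I_n) s Phi v t :
  valid b e s Phi -> ever_protected Phi v -> v \notin burned e s Phi t.
Proof.
move=> [notB _] /existsP[i iP]; elim: t => [|t IH].
  apply: contra (notB _ _ iP); exact: (subsetP (burned_mono _ _ _ (leq0n _))).
case: (leqP t.+1 i.+1) => [ti|it].
  apply: contra (notB _ _ iP); exact: (subsetP (burned_mono _ _ _ ti)).
rewrite in_burnedS (negbTE IH) orFb !negb_and negbK; apply/or3P; apply: Or32.
by  rewrite inE; apply/existsP; exists i; rewrite iP andbT.
Qed.

(** A burned vertex is refuted as saved by the one-vertex path at itself. Conversely, fire would run
    along any path free of protected vertices up to its end. *)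
Lemma savedE n b (e : rel 'I_n) s Phi v :
  valid b e s Phi -> saved e s Phi v <-> v \notin burned e s Phi n.
Proof.
move=> vP; split=> [sv|vN].
  apply/negP=> vB; have vNP : ~ ever_protected Phi v.
    by move=> ep; move: (protected_not_burned n vP ep); rewrite vB.
  case: sv => // /(_ v [::] (ex_intro _ n vB) isT isT (erefl _)) /=.
  by rewrite orbF.
right=> u p [t ut] up _ pl; apply: contraNT vN; rewrite -pl => /hasPn pN.
have {ut} : u \in burned e s Phi n by apply: (subsetP (burned_sub_final _ _ _ t)).
elim: p u up pN {pl} => //= w p IH u /andP[euw wp] pN uB.
apply: IH wp _ _ => [x xp|]; first by apply: pN; rewrite inE xp orbT.
(* The spread from time [n] to [n.+1] adds nothing new, so the set burned at time [n] is closed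
   under it. *)
apply: (subsetP (burned_sub_final e s Phi n.+1)); rewrite in_burnedS; apply/orP; right.
apply/and3P; split; first exact: leq_ltn_trans (leq0n _) (ltn_ord u).
  by apply: contra (pN w _); [apply: protected_ever_protected | rewrite !inE eqxx orbT].
by apply/exists_inP; exists u.
Qed.

Lemma burned_eq_protected n (e : rel 'I_n) s Phi Psi B t :
  (forall t', t' < B -> protected Phi t' = protected Psi t') -> t <= B ->
  burned e s Phi t = burned e s Psi t.
Proof.
move=> eqP; elim: t => // t IH tB; apply/setP=> v.
by rewrite !in_burnedS eqP // IH // ltnW.
Qed.

(** * Dropping late protections *)

Definition truncate n (B : nat) (Phi : strategy n) : strategy n :=
  [set p in Phi | p.2 < B].

(** Up to time [B] the fire depends only on protections made before [B], which both strategies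
    share; after [B] both fires are stable. *)
Lemma burned_truncate n (e : rel 'I_n) s (Phi : strategy n) B t :
  path_bound e B -> burned e s (truncate B Phi) t = burned e s Phi t.
Proof.
move=> eB.
have eq_le t' : t' <= B -> burned e s (truncate B Phi) t' = burned e s Phi t'.
  apply: burned_eq_protected => u uB; apply/setP=> v; rewrite !inE.
  apply: eq_existsb => i; rewrite inE /=.
  by case: (leqP i.+1 u) => //= iu; rewrite (ltn_trans iu uB) andbT.
case: (leqP t B) => [/eq_le //|/ltnW Bt].
by rewrite !(burned_stable _ _ eB Bt) eq_le.
Qed.

Lemma valid_truncate n b (e : rel 'I_n) s (Phi : strategy n) B :
  path_bound e B -> valid b e s Phi -> valid b e s (truncate B Phi).
Proof.
move=> eB [notB leb]; split=> [v i|i].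
  by rewrite inE burned_truncate // => /andP[/notB].
apply: leq_trans (leb i); apply: subset_leq_card; apply/subsetP=> v.
by rewrite !inE => /andP[].
Qed.

Lemma size_filter_iota n (p : pred nat) :
  size [seq v <- iota 0 n | p v] = #|[set v : 'I_n | p v]|.
Proof.
rewrite size_filter -sum1_count -sum1_card.
have := big_mkord p (fun=> 1) (n := n) (op := addn) (idx := 0).
rewrite /index_iota subn0 => ->.
by apply: eq_bigl => v; rewrite inE.
Qed.

(** At most [B] time steps survive the truncation, and the budget allows [b] pairs in each. *)
Lemma card_truncate n b (e : rel 'I_n) s (Phi : strategy n) B :
  valid b e s Phi -> #|truncate B Phi| <= B * b.
Proof.
move=> [_ leb]; rewrite -sum1_card (partition_big snd xpredT) //=.
apply: (@leq_trans (\sum_(i in [set i : 'I_n | i < B]) b)).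
  rewrite [X in _ <= X]big_mkcond; apply: leq_sum => i _.
  rewrite sum1_card inE; case: ifP => iB.
    apply: leq_trans (leb i).
    rewrite -[X in _ <= X](card_imset _ (_ : injective (pair^~ i))).
      apply: subset_leq_card; apply/subsetP => - [v j] /=.
      rewrite unfold_in /= !inE => /andP[/andP[vj _] /eqP ji]; rewrite -ji.
      by apply/imsetP; exists v; rewrite ?inE.
    by move=> u v [].
  rewrite leqn0; apply/eqP/eq_card0 => - [v j]; rewrite unfold_in /= !inE /=.
  by apply/negP => /andP[/andP[_ jB] /eqP ji]; rewrite -ji jB in iB.
rewrite sum_nat_const leq_mul2r; apply/orP; right.
rewrite -(size_filter_iota n (fun i => i < B)) -[X in _ <= X](size_iota 0).
apply: uniq_leq_size; first by rewrite filter_uniq // iota_uniq.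
by move=> i; rewrite mem_filter !mem_iota !add0n => /andP[].
Qed.

Lemma saved_weightE b (x : instance) (Phi : strategy (nvertices x)) :
  valid b (@edge x) (source x) Phi ->
  saved_weight Phi =
  \sum_(v in target x |
         v \notin burned (@edge x) (source x) Phi (nvertices x)) weight v.
Proof.
move=> vP; apply: eq_bigl => v; congr (_ && _).
by apply/asboolP/idP => /(savedE _ vP).
Qed.

(** * Correctness of the search *)

Definition bits (m : nat) : seq bool :=
  [seq odd (m %/ 2 ^ i) | i <- iota 0 (up_log 2 m.+1)].

Lemma bits_valK m : bits_val (bits m) = m.
Proof.
have : m < 2 ^ up_log 2 m.+1 by apply: up_logP.
rewrite /bits; move: (up_log _ _) => l; elim: l m => [|l IH] m.
  by rewrite expn0 ltnS leqn0 => /eqP->.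
move=> ml; rewrite -[iota 0 l.+1]/(0 :: iota 1 l) (iotaDl 1 0) /= expn0 divn1.
rewrite -map_comp (_ : map _ _ = [seq odd (m./2 %/ 2 ^ i) | i <- iota 0 l]).
  rewrite IH ?odd_double_half //.
  by move: ml; rewrite expnS; have := odd_double_half m; lia.
by apply: eq_map => i /=; rewrite add1n expnS divnMA divn2.
Qed.

Definition raw (x : instance) : raw_instance :=
  let V := enum 'I_(nvertices x) in
  ([seq [seq edge u v | v <- V] | u <- V],
   ([seq v == source x | v <- V],
    ([seq if v \in target x then Some (bits (weight v)) else None | v <- V], tt))).

Lemma enc_seq_map (A B : Type) {eB : encoding B} (f : A -> B) s :
  encode (map f s) = enc_seq [seq encode (f a) | a <- s].
Proof. by rewrite /encode /encoding_seq -map_comp. Qed.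

(** Nested pairs closed by a [unit], encoded as [Leaf], form the same tree as the three-element list
    of the input format. *)
Lemma enc_instanceE x : enc_instance x = encode (raw x).
Proof.
rewrite -[RHS]/(enc_seq [:: encode (raw x).1; encode (raw x).2.1; encode (raw x).2.2.1]).
congr (enc_seq [:: _; _; _]); rewrite /= enc_seq_map //.
- by congr enc_seq; apply: eq_map => u; rewrite enc_seq_map.
- congr enc_seq; apply: eq_map => v; case: ifP => // _.
  by rewrite -[RHS]/(Node Leaf (encode (bits (weight v)))) /bits enc_seq_map.
Qed.

Lemma vertices_raw x : vertices (raw x) = iota 0 (nvertices x).
Proof. by rewrite /vertices size_map size_enum_ord. Qed.

Lemma nth_map_enum n T (x0 : T) (f : 'I_n -> T) (v : 'I_n) :
  nth x0 [seq f u | u <- enum 'I_n] v = f v.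
Proof. by rewrite (nth_map v) ?size_enum_ord // nth_ord_enum. Qed.

Lemma adj_raw x (u v : 'I_(nvertices x)) : adj (raw x) u v = edge u v.
Proof. by rewrite /adj !nth_map_enum. Qed.

Lemma weight_bits_raw x (v : 'I_(nvertices x)) :
  bits_val (weight_bits (raw x) v) = if v \in target x then weight v else 0.
Proof.
by rewrite /weight_bits nth_map_enum; case: ifP => //= _; rewrite bits_valK.
Qed.

Definition strategy_of n (c : seq (nat * nat)) : strategy n :=
  [set p : 'I_n * 'I_n | plays c p.1 p.2].

Definition in_range n (c : seq (nat * nat)) : bool :=
  all (fun p => (p.1 < n) && (p.2 < n)) c.

Lemma playsE c v i : plays c v i = ((v, i) \in c).
Proof. by rewrite -has_pred1; apply: eq_has => - [w j]; rewrite /= xpair_eqE. Qed.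

Lemma mem_natE B v : mem_nat B v = (v \in B).
Proof. by rewrite -has_pred1. Qed.

Lemma shieldedE n c t (v : 'I_n) : in_range n c ->
  shielded c t v = (v \in protected (strategy_of n c) t).
Proof.
move=> /allP rc; rewrite inE; apply/hasP/existsP.
  move=> [[w j] cw /= /andP[/eqP wv jt]]; subst w.
  case/andP: (rc _ cw) => /= _ jn; exists (Ordinal jn).
  by rewrite jt inE playsE.
move=> [i /andP[it]]; rewrite inE playsE => ic.
by exists (val v, val i) => //=; rewrite eqxx.
Qed.

Lemma burnS G c t : burn G c t.+1 = burn_step G c (burn G c t) t.
Proof. by rewrite /burn -[t.+1]addn1 iotaD foldl_cat. Qed.

Lemma burn_lt x c t u : u \in burn (raw x) c t -> u < nvertices x.
Proof.
case: t => [|t]; rewrite ?burnS mem_filter => /andP[_];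
by rewrite vertices_raw mem_iota add0n.
Qed.

Lemma mem_burn x c t (v : 'I_(nvertices x)) : in_range (nvertices x) c ->
  (val v \in burn (raw x) c t) =
  (v \in burned (@edge x) (source x) (strategy_of _ c) t).
Proof.
move=> rc; elim: t v => [|t IH] v.
  by rewrite mem_filter vertices_raw mem_iota /= ltn_ord andbT nth_map_enum in_set1.
rewrite burnS in_burnedS mem_filter vertices_raw mem_iota /= ltn_ord andbT.
rewrite mem_natE IH -shieldedE //; congr (_ || [&& _, _ & _]).
apply/hasP/exists_inP => [[u ub]|[u ub uv]].
  have un := burn_lt ub; rewrite -[u]/(val (Ordinal un)) adj_raw => uv.
  by exists (Ordinal un); rewrite -?IH.
by exists (val u); rewrite ?IH ?adj_raw.
Qed.

Lemma legalP b x c : in_range (nvertices x) c ->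
  reflect (valid b (@edge x) (source x) (strategy_of _ c)) (legal b (raw x) c).
Proof.
move=> rc; rewrite /legal vertices_raw.
apply: (iffP andP) => - [notB leb]; split.
- move=> v i; rewrite inE playsE => /(allP notB) /=.
  by rewrite mem_natE mem_burn.
- move=> i; have := allP leb i; rewrite mem_iota size_filter_iota => /(_ (ltn_ord i)).
  by apply: leq_trans; apply: subset_leq_card; apply/subsetP=> v; rewrite !inE.
- apply/allP=> - [v i] vi; case/andP: (allP rc _ vi) => /= vn iN.
  rewrite mem_natE -[v]/(val (Ordinal vn)) mem_burn //.
  by apply: (notB _ (Ordinal iN)); rewrite inE playsE.
- apply/allP=> i; rewrite mem_iota add0n => iN; rewrite size_filter_iota.
  apply: leq_trans (leb (Ordinal iN)); apply: subset_leq_card.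
  by apply/subsetP=> v; rewrite !inE.
Qed.

Lemma bits_val_sum l : bits_val (foldl bits_add [::] l) = \sum_(y <- l) bits_val y.
Proof.
elim/last_ind: l => [|l y IH]; first by rewrite big_nil.
by rewrite foldl_rcons bits_add_val IH -cats1 big_cat big_seq1.
Qed.

(** Legality is needed because saved vertices are identified with unburned ones only for valid
    strategies. *)
Lemma bits_val_value b x c : in_range (nvertices x) c ->
  legal b (raw x) c ->
  bits_val (value (raw x) c) = saved_weight (strategy_of (nvertices x) c).
Proof.
move=> rc /(legalP _ rc) vc; rewrite (saved_weightE vc).
rewrite bits_val_sum big_map big_filter vertices_raw size_map size_enum_ord.
have := big_mkord (fun v => ~~ mem_nat (burn (raw x) c (nvertices x)) v)
  (fun v => bits_val (weight_bits (raw x) v)) (n := nvertices x) (op := addn) (idx := 0).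
rewrite /index_iota subn0 => ->.
rewrite big_mkcond [RHS]big_mkcond /=; apply: eq_bigr => v _.
rewrite mem_natE mem_burn // weight_bits_raw.
by case: (v \in target x); case: (_ \notin _).
Qed.

Lemma mem_pairs x v i :
  ((v, i) \in pairs (raw x)) = (v < nvertices x) && (i < nvertices x).
Proof.
rewrite -[pairs _]/[seq (v, i) | v <- vertices (raw x), i <- vertices (raw x)].
rewrite vertices_raw; apply/allpairsP/andP => [[[w j] /=]|[vn iN]].
  by rewrite !mem_iota !add0n => - [? ? [-> ->]].
by exists (v, i); rewrite !mem_iota.
Qed.

Lemma mem_candidates D x c :
  (c \in candidates D (raw x)) = (size c <= D) && in_range (nvertices x) c.
Proof.
elim: D c => [|D IH] c; first by rewrite mem_seq1 leqn0 size_eq0; case: c.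
rewrite mem_cat IH; apply/orP/andP => [[/andP[cD rc]|]|[cD rc]].
- by rewrite (leq_trans cD).
- move=> /flatten_mapP[c' +] /mapP[[v i] vi ->].
  by rewrite IH => /andP[c'D rc]; rewrite /= rc -mem_pairs vi.
- case: c cD rc => [|[v i] c] cD; first by left.
  case/andP => vi rc; right; apply/flatten_mapP.
  exists c; first by rewrite IH; apply/andP.
  by apply/mapP; exists (v, i) => //; rewrite mem_pairs.
Qed.

(** The seed [x0] is never tested by the fold, so that it counts in the maximum as it is and its own
    [ok] is a premise of [ok y]. *)
Lemma foldl_max_spec (T : eqType) (ok : pred T) (w : T -> nat) (x0 : T) (l : seq T) :
  let y := foldl (fun y x => if ok x && (w y <= w x) then x else y) x0 l in
  [/\ y \in x0 :: l, ok x0 -> ok y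
    & forall x, x \in x0 :: l -> (x == x0) || ok x -> w x <= w y].
Proof.
elim/last_ind: l => [|l x [IHm IHok IHmax]] /=.
  by split=> // [|x]; rewrite mem_seq1 // => /eqP->.
rewrite foldl_rcons; move: (foldl _ _ _) IHm IHok IHmax => y IHm IHok IHmax.
split.
- by case: ifP => _; rewrite -rcons_cons mem_rcons inE ?eqxx ?IHm ?orbT.
- by case: ifP => // /andP[].
- move=> z; rewrite -rcons_cons mem_rcons inE => /orP[/eqP-> {z}|zl zok].
    case: ifP => // xy; case/orP => [/eqP xx0|okx].
      by apply: IHmax; rewrite xx0 ?inE eqxx.
    by move: xy; rewrite okx /= => /negbT; rewrite -ltnNge => /ltnW.
  apply: leq_trans (IHmax z zl zok) _.
  by case: ifP => // /andP[].
Qed.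

Lemma strategy_of_enum n (Phi : strategy n) :
  strategy_of n [seq (val p.1, val p.2) | p <- enum Phi] = Phi.
Proof.
apply/setP=> - [v i]; rewrite inE playsE /=; apply/mapP/idP.
  by move=> [[w j]]; rewrite mem_enum /= => wj [/ord_inj-> /ord_inj->].
by move=> vi; exists (v, i); rewrite ?mem_enum.
Qed.

Lemma encode_strategy_matrix x c :
  encode (strategy_matrix (raw x) c) = enc_strategy (strategy_of (nvertices x) c).
Proof.
rewrite /strategy_matrix vertices_raw -val_enum_ord -map_comp enc_seq_map.
congr enc_seq; apply: eq_map => v /=; rewrite -map_comp enc_seq_map.
by congr enc_seq; apply: eq_map => i /=; rewrite inE.
Qed.

Lemma valid_nil b x : legal b (raw x) [::].
Proof.
apply/andP; split=> //; apply/allP => i _.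
by rewrite (eq_filter (a2 := pred0)) // filter_pred0.
Qed.

Lemma bestE b D G :
  best b D G = foldl (fun c c' =>
    if legal b G c' && (bits_val (value G c) <= bits_val (value G c'))
    then c' else c) [::] (candidates D G).
Proof.
rewrite /best; elim: (candidates _ _) ([::] : seq (nat * nat)) => //= c l IH y.
by rewrite bits_leqE IH.
Qed.

(** A valid [Psi] burns the same vertices as its truncation, which is still valid and has at most
    [B * b] pairs. An enumeration of the truncation is thus a legal candidate with the same saved
    weight. *)
Lemma best_optimal b B x : path_bound (@edge x) B ->
  optimal b (strategy_of (nvertices x) (best b (B * b) (raw x))).
Proof.
move=> eB; have := foldl_max_spec (legal b (raw x))
  (fun c => bits_val (value (raw x) c)) [::] (candidates (B * b) (raw x)).
rewrite /= -bestE.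
move: (best _ _ _) => c [cm /(_ (valid_nil b x)) cok cmax].
have rc : in_range (nvertices x) c.
  by move: cm; rewrite inE mem_candidates => /orP[/eqP-> //|/andP[]].
split=> [|Psi vPsi]; first exact/(legalP b rc).
have vT := valid_truncate eB vPsi.
pose d := [seq (val p.1, val p.2) | p <- enum (truncate B Psi)].
have dE : strategy_of _ d = truncate B Psi by apply: strategy_of_enum.
have rd : in_range (nvertices x) d.
  by apply/allP => _ /mapP[p _ ->]; rewrite /= !ltn_ord.
have okd : legal b (raw x) d by apply/(legalP b rd); rewrite dE.
have -> : saved_weight Psi = @saved_weight x (strategy_of _ d).
  rewrite dE (saved_weightE vPsi) (saved_weightE vT).
  by apply: eq_bigl => v; rewrite burned_truncate.
rewrite -(bits_val_value rd okd) -(bits_val_value rc cok).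
apply: cmax; last by rewrite okd orbT.
rewrite inE mem_candidates rd andbT size_map -cardE.
by rewrite (card_truncate _ vPsi) orbT.
Qed.

Theorem theorem4 (k b : nat) (hk : 1 <= k) (hb : 1 <= b) :
  poly_time_solvable enc_instance (fun x : instance => is_kstar k (@edge x))
    (max_weighted_save_answer b).
Proof.
(* The number of rounds, [2k + 1] time steps with [b] protections each, is fixed before the instance
   is given. *)
apply: (ptime_poly_time_solvable (ptime_solve b (k.*2.+1 * b)) enc_instanceE).
move=> x xk; exists (strategy_of _ (best b (k.*2.+1 * b) (raw x))).
  exact: best_optimal (kstar_path_bound xk).
exact: encode_strategy_matrix.
Qed.
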